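(* If $\{\mathcal{S}_n\}_{n=1}^\infty$ is an inductive system of $(\min,\mathrm{c})$-nuclear operator systems with unital complete order embeddings $u_n:\mathcal{S}_n\to\mathcal{S}_{n+1}$, $n\in\mathbb{N}$, as connecting maps, then $\varinjlim\mathcal{S}_n$ is also $(\min,\mathrm{c})$-nuclear.
   Context: An operator system is a unital self-adjoint subspace of $B(H)$. The inductive limit $\varinjlim\mathcal{S}_n$ along unital complete order embeddings $u_n$ is the operator system $\mathcal{S}$ with unital complete order embeddings $\lambda_n:\mathcal{S}_n\to\mathcal{S}$ satisfying $\lambda_n=\lambda_{n+1}\circ u_n$ and $\mathcal{S}=\overline{\bigcup_n\lambda_n(\mathcal{S}_n)}$, universal for compatible families of unital completely positive maps. For operator systems $\mathcal{S},\mathcal{T}$, the tensor products are operator system structures on the algebraic tensor product. $\min$: $u\in M_n(\mathcal{S}\otimes_{\min}\mathcal{T})^+$ iff $(\varphi\otimes\psi)^{(n)}(u)\ge 0$ for all unital completely positive maps $\varphi:\mathcal{S}\to M_k$, $\psi:\mathcal{T}\to M_m$, $k,m\in\mathbb{N}$. $\mathrm{c}$ (maximal commuting): $u\in M_n(\mathcal{S}\otimes_{\mathrm{c}}\mathcal{T})^+$ iff $(\varphi\cdot\psi)^{(n)}(u)\ge0$ for all Hilbert spaces $H$ and completely positive maps $\varphi:\mathcal{S}\to B(H)$, $\psi:\mathcal{T}\to B(H)$ with commuting ranges, where $(\varphi\cdot\psi)(s\otimes t)=\varphi(s)\psi(t)$. For operator system tensor products $\alpha,\beta$, $\mathcal{S}$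 is $(\alpha,\beta)$-nuclear if the identity map $\mathcal{S}\otimes_\alpha\mathcal{T}\to\mathcal{S}\otimes_\beta\mathcal{T}$ is a complete order isomorphism for every operator system $\mathcal{T}$. *)

(* Defs.v *)
From HB Require Import structures.
From mathcomp Require Import all_boot all_order all_algebra.
From mathcomp Require Import generic_quotient.
From mathcomp Require Import all_classical all_reals all_analysis.
From mathcomp Require Import complex mxtens.

Set Implicit Arguments.
Unset Strict Implicit.
Unset Printing Implicit Defensive.

Import Order.TTheory GRing.Theory Num.Theory.
Import numFieldNormedType.Exports.

Local Open Scope quotient_scope.
Local Open Scope ring_scope.

(** Algebraic tensor product of two modules: finite formal sums of pairs (u, v),
    standing for u (x) v, modulo having the same image under every bilinear map.
    Scalars are absorbed in the first component of a pair. *)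
Section Tensor.
Variables (K : comNzRingType) (U V : lmodType K).

Definition formal_eval (W : lmodType K) (f : U -> V -> W) (s : seq (U * V)) : W :=
  \sum_(p <- s) f p.1 p.2.

Definition tensor_rel (s t : seq (U * V)) : bool :=
  `[< forall (W : lmodType K) (f : {bilinear U -> V -> W}),
        formal_eval f s = formal_eval f t >].

Lemma tensor_rel_refl : reflexive tensor_rel.
Proof. by move=> s; apply/asboolP. Qed.

Lemma tensor_rel_sym : symmetric tensor_rel.
Proof. by move=> s t; apply/asboolP/asboolP => + W f => ->. Qed.

Lemma tensor_rel_trans : transitive tensor_rel.
Proof.
by move=> s t r /asboolP ts /asboolP sr; apply/asboolP => W f; rewrite ts.
Qed.

Canonical tensor_equiv :=
  EquivRel tensor_rel tensor_rel_refl tensor_rel_sym tensor_rel_trans.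

Definition tensor := {eq_quot tensor_equiv}.
HB.instance Definition _ := Choice.on tensor.
HB.instance Definition _ := Quotient.on tensor.

Definition tens (u : U) (v : V) : tensor := \pi_tensor [:: (u, v)].

Section Lift.
Variables (W : lmodType K) (f : {bilinear U -> V -> W}).

Definition tensor_lift (x : tensor) : W := formal_eval f (repr x).

Lemma tensor_liftE s : tensor_lift (\pi_tensor s) = formal_eval f s.
Proof.
by rewrite /tensor_lift; case: piP => t /eqmodP /asboolP /(_ W f) ->.
Qed.

Lemma tensor_lift_tens u v : tensor_lift (tens u v) = f u v.
Proof. by rewrite tensor_liftE /formal_eval big_seq1. Qed.
End Lift.

Lemma tensorP (x y : tensor) :
  (forall (W : lmodType K) (f : {bilinear U -> V -> W}),
     tensor_lift f x = tensor_lift f y) -> x = y.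
Proof.
move=> xy; rewrite -(reprK x) -(reprK y); apply/eqmodP/asboolP => W f.
exact: xy.
Qed.

Definition tensor_add (x y : tensor) : tensor := \pi_tensor (repr x ++ repr y).
Definition tensor_scale (a : K) (x : tensor) : tensor :=
  \pi_tensor [seq (a *: p.1, p.2) | p <- repr x].
Definition tensor_zero : tensor := \pi_tensor [::].
Definition tensor_opp (x : tensor) : tensor := tensor_scale (- 1) x.

Section LiftLinear.
Variables (W : lmodType K) (f : {bilinear U -> V -> W}).

Lemma tensor_lift_add x y :
  tensor_lift f (tensor_add x y) = tensor_lift f x + tensor_lift f y.
Proof. by rewrite tensor_liftE /formal_eval big_cat. Qed.

Lemma tensor_lift_zero : tensor_lift f tensor_zero = 0.
Proof. by rewrite tensor_liftE /formal_eval big_nil. Qed.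

Lemma tensor_lift_scale a x :
  tensor_lift f (tensor_scale a x) = a *: tensor_lift f x.
Proof.
rewrite tensor_liftE /tensor_lift /formal_eval big_map scaler_sumr.
by apply: eq_bigr => p _; rewrite linearZl_LR.
Qed.
End LiftLinear.

Let liftE :=
  (tensor_lift_add, tensor_lift_zero, tensor_lift_scale).

Lemma tensor_addA : associative tensor_add.
Proof. by move=> x y z; apply: tensorP => W f; rewrite !liftE addrA. Qed.

Lemma tensor_addC : commutative tensor_add.
Proof. by move=> x y; apply: tensorP => W f; rewrite !liftE addrC. Qed.

Lemma tensor_add0 : left_id tensor_zero tensor_add.
Proof. by move=> x; apply: tensorP => W f; rewrite !liftE add0r. Qed.

Lemma tensor_addN : left_inverse tensor_zero tensor_opp tensor_add.
Proof. by move=> x; apply: tensorP => W f; rewrite !liftE scaleN1r addNr. Qed.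

HB.instance Definition _ := GRing.isZmodule.Build tensor
  tensor_addA tensor_addC tensor_add0 tensor_addN.

Lemma tensor_scaleA a b x :
  tensor_scale a (tensor_scale b x) = tensor_scale (a * b) x.
Proof. by apply: tensorP => W f; rewrite !liftE scalerA. Qed.

Lemma tensor_scale1 : left_id 1 tensor_scale.
Proof. by move=> x; apply: tensorP => W f; rewrite !liftE scale1r. Qed.

Lemma tensor_scaleDr : right_distributive tensor_scale +%R.
Proof. by move=> a x y; apply: tensorP => W f; rewrite !liftE scalerDr. Qed.

Lemma tensor_scaleDl x : {morph tensor_scale^~ x : a b / a + b}.
Proof. by move=> a b; apply: tensorP => W f; rewrite !liftE scalerDl. Qed.

HB.instance Definition _ := GRing.Zmodule_isLmodule.Build K tensor
  tensor_scaleA tensor_scale1 tensor_scaleDr tensor_scaleDl.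

Lemma tensor_lift_linear (W : lmodType K) (f : {bilinear U -> V -> W}) :
  linear (tensor_lift f).
Proof. by move=> a x y; rewrite tensor_lift_add tensor_lift_scale. Qed.

HB.instance Definition _ (W : lmodType K) (f : {bilinear U -> V -> W}) :=
  GRing.isLinear.Build K tensor W *:%R (tensor_lift f) (tensor_lift_linear f).

Lemma tens_bilinear : bilinear_for *:%R *:%R tens.
Proof.
split=> [v a u u'|u a v v']; apply: tensorP => W f;
  by rewrite linearP /= !tensor_lift_tens ?linearPl ?linearPr.
Qed.

HB.instance Definition _ :=
  bilinear_isBilinear.Build K U V tensor *:%R *:%R tens tens_bilinear.

End Tensor.

Record hilbert (R : realType) := Hilbert {
  hilbert_sort :> completeNormedModType R[i];
  ip : {dot hilbert_sort for Num.conj};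
  ip_norm : forall x, ip x x = `|x| ^+ 2
}.
Arguments ip {R} h.

Section BoundedOperators.
Variables (R : realType) (H : hilbert R).

Definition bounded_op : {pred H -> H} :=
  fun A => `[< linear A /\ exists M : R[i], forall x, `|A x| <= M * `|x| >].

Lemma bounded_op_submod : submod_closed bounded_op.
Proof.
split=> [|a A B /asboolP[lA [M bA]] /asboolP[lB [N bB]]]; apply/asboolP; split.
- by move=> a x y; rewrite /= scaler0 addr0.
- by exists 0 => x; rewrite normr0 mul0r.
- by move=> b x y; rewrite !fctE lA lB !scalerDr !scalerA mulrC addrACA.
- exists (`|a| * M + N) => x; rewrite !fctE (le_trans (ler_normD _ _)) //.
  by rewrite normrZ mulrDl lerD // -mulrA ler_wpM2l.
Qed.

HB.instance Definition _ := GRing.isSubmodClosed.Build R[i] (H -> H) bounded_op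
  bounded_op_submod.

Record bop := Bop { bop_fun :> H -> H; bop_funP : bop_fun \in bounded_op }.

HB.instance Definition _ := [isSub for bop_fun].
HB.instance Definition _ := [Choice of bop by <:].
HB.instance Definition _ := [SubChoice_isSubLmodule of bop by <:].

Lemma bop_id_subproof : (id : H -> H) \in bounded_op.
Proof. by apply/asboolP; split=> //; exists 1 => x; rewrite mul1r. Qed.
Definition bop_id : bop := Bop bop_id_subproof.

Lemma bop_comp_subproof (A B : bop) : (A \o B : H -> H) \in bounded_op.
Proof.
case: A B => [A /= /asboolP[lA [M bA]]] [B /= /asboolP[lB [N bB]]].
apply/asboolP; split=> [a x y|]; first by rewrite /= lB lA.
have normM (L : R[i]) (C : H -> H) x : `|C x| <= L * `|x| -> `|C x| <= `|L| * `|x|.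
  move=> bC; have L0 : 0 <= L * `|x| by exact: le_trans bC.
  by rewrite -[`|x|]normr_id -normrM (ger0_norm L0).
exists (`|M| * `|N|) => x /=; rewrite (le_trans (normM M A _ (bA _))) //.
by rewrite -mulrA ler_wpM2l // normM.
Qed.
Definition bop_comp (A B : bop) : bop := Bop (bop_comp_subproof A B).

Definition adjoint_of (A B : bop) := forall x y, ip H (A x) y = ip H x (B y).

Definition op_norm_le (A : bop) (c : R[i]) := forall x, `|A x| <= c * `|x|.

(** Closure for the operator norm; note that [0 < e] in R[i] says that e is a
    positive real. *)
Definition op_closure (D : bop -> Prop) (A : bop) :=
  forall e : R[i], 0 < e -> exists2 B, D B & op_norm_le (A - B) e.

(** M_n(B(H))^+, with M_n(B(H)) acting on H^n. *)
Definition bop_mx_pos n (A : 'M[bop]_n) :=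
  forall x : 'I_n -> H, 0 <= \sum_i \sum_j ip H (A i j (x j)) (x i).

End BoundedOperators.

(** M_n(M_k)^+, with M_n(M_k) acting on (C^k)^n. *)
Definition mat_mx_pos (R : realType) k n (A : 'M['M[R[i]]_k]_n) :=
  forall x : 'I_n -> 'cV[R[i]]_k,
    0 <= (\sum_i \sum_j (map_mx Num.conj (x i))^T *m A i j *m x j) 0 0.

Record osys (R : realType) := OSys {
  os_hilb : hilbert R;
  os_carrier : {pred bop os_hilb};
  os_submod : submod_closed os_carrier;
  os_id : bop_id os_hilb \in os_carrier;
  os_adj : forall A, A \in os_carrier ->
    exists2 B, B \in os_carrier & adjoint_of A B
}.
Arguments os_carrier {R} o.

HB.instance Definition _ (R : realType) (S : osys R) :=
  GRing.isSubmodClosed.Build R[i] (bop (os_hilb S)) (os_carrier S) (os_submod S).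

Section OsysElements.
Variables (R : realType) (S : osys R).

Record os_elt := OSElt {
  os_val :> bop (os_hilb S);
  os_valP : os_val \in os_carrier S
}.

HB.instance Definition _ := [isSub for os_val].
HB.instance Definition _ := [Choice of os_elt by <:].
HB.instance Definition _ := [SubChoice_isSubLmodule of os_elt by <:].

Definition os_one : os_elt := OSElt (os_id S).

Definition os_mx_pos n (A : 'M[os_elt]_n) := bop_mx_pos (map_mx os_val A).

Definition os_complete :=
  forall A, op_closure (fun B => B \in os_carrier S) A -> A \in os_carrier S.

End OsysElements.

Coercion os_elt : osys >-> Sortclass.

(** Maps between spaces V, W whose matrix spaces carry cones posV, posW. *)
Section MatrixOrder.
Variables (V W : Type).
Variables (posV : forall n, 'M[V]_n -> Prop) (posW : forall n, 'M[W]_n -> Prop).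

Definition completely_positive (f : V -> W) :=
  forall n (A : 'M[V]_n), posV A -> posW (map_mx f A).

Definition complete_order_embedding (f : V -> W) :=
  injective f /\ forall n (A : 'M[V]_n), posV A <-> posW (map_mx f A).

Definition complete_order_iso (f : V -> W) :=
  bijective f /\ forall n (A : 'M[V]_n), posV A <-> posW (map_mx f A).

End MatrixOrder.

Section OsysMaps.
Variables (R : realType).

Definition ucp (S T : osys R) (f : {linear S -> T}) :=
  f (os_one S) = os_one T /\
  completely_positive (@os_mx_pos R S) (@os_mx_pos R T) f.

Definition unital_coe (S T : osys R) (f : {linear S -> T}) :=
  f (os_one S) = os_one T /\
  complete_order_embedding (@os_mx_pos R S) (@os_mx_pos R T) f.

Definition ucp_mat (S : osys R) k (f : {linear S -> 'M[R[i]]_k}) :=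
  f (os_one S) = 1%:M /\
  completely_positive (@os_mx_pos R S) (@mat_mx_pos R k) f.

Definition cp_bop (S : osys R) (H : hilbert R) (f : {linear S -> bop H}) :=
  completely_positive (@os_mx_pos R S) (@bop_mx_pos R H) f.

End OsysMaps.

(** phi (x) psi, with M_k (x) M_m identified with M_(k * m) by the Kronecker
    product. *)
Section TensorMaps.
Variables (R : realType) (S T : osys R) (k m : nat).
Variables (phi : {linear S -> 'M[R[i]]_k}) (psi : {linear T -> 'M[R[i]]_m}).

Definition kron_form (s : S) (t : T) : 'M[R[i]]_(k * m) := tensmx (phi s) (psi t).

Lemma kron_form_bilinear : bilinear_for *:%R *:%R kron_form.
Proof.
split=> [t a s s'|s a t t']; apply/matrixP => i j; rewrite /= /kron_form linearP !mxE.
- by rewrite mulrDl mulrA.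
- by rewrite mulrDr mulrCA.
Qed.

HB.instance Definition _ :=
  bilinear_isBilinear.Build R[i] S T 'M[R[i]]_(k * m) *:%R *:%R kron_form
    kron_form_bilinear.

Definition tensor_map : tensor S T -> 'M[R[i]]_(k * m) := tensor_lift kron_form.

Lemma tensor_map_tens s t : tensor_map (tens s t) = tensmx (phi s) (psi t).
Proof. exact: tensor_lift_tens. Qed.

End TensorMaps.

Section ProductMap.
Variables (R : realType) (S T : osys R) (H : hilbert R).
Variables (phi : {linear S -> bop H}) (psi : {linear T -> bop H}).

Definition comp_form (s : S) (t : T) : bop H := bop_comp (phi s) (psi t).

Lemma comp_form_bilinear : bilinear_for *:%R *:%R comp_form.
Proof.
split=> [t a s s'|s a t t']; apply/val_inj/funext => x; rewrite /comp_form /= linearP //=.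
by case: (phi s) => A /= /asboolP[lA _]; rewrite !fctE lA.
Qed.

HB.instance Definition _ :=
  bilinear_isBilinear.Build R[i] S T (bop H) *:%R *:%R comp_form
    comp_form_bilinear.

Definition product_map : tensor S T -> bop H := tensor_lift comp_form.

Lemma product_map_tens s t : product_map (tens s t) = bop_comp (phi s) (psi t).
Proof. exact: tensor_lift_tens. Qed.

End ProductMap.

Definition tensor_structure (R : realType) :=
  forall (S T : osys R) n, 'M[tensor S T]_n -> Prop.

Definition min_tensor (R : realType) : tensor_structure R := fun S T n u =>
  forall k m (phi : {linear S -> 'M[R[i]]_k}) (psi : {linear T -> 'M[R[i]]_m}),
    ucp_mat phi -> ucp_mat psi -> mat_mx_pos (map_mx (tensor_map phi psi) u).

Definition c_tensor (R : realType) : tensor_structure R := fun S T n u =>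
  forall (H : hilbert R) (phi : {linear S -> bop H}) (psi : {linear T -> bop H}),
    cp_bop phi -> cp_bop psi ->
    (forall s t, bop_comp (phi s) (psi t) = bop_comp (psi t) (phi s)) ->
    bop_mx_pos (map_mx (product_map phi psi) u).

Definition nuclear (R : realType) (alpha beta : tensor_structure R) (S : osys R) :=
  forall T : osys R,
    complete_order_iso (alpha S T) (beta S T) (id : tensor S T -> tensor S T).

(** S is the inductive limit of (S_ n, u n), with canonical maps lam n. It is
    closed, so its universal property is among norm-closed operator systems: a
    codomain T that is not closed cannot in general receive an extension to the
    closure of the union. *)
Definition is_inductive_limit (R : realType) (S_ : nat -> osys R)
    (u : forall n, {linear S_ n -> S_ n.+1})
    (S : osys R) (lam : forall n, {linear S_ n -> S}) :=
  [/\ forall n, unital_coe (lam n),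
      forall n x, lam n x = lam n.+1 (u n x),
      forall A : bop (os_hilb S), A \in os_carrier S <->
        op_closure (fun B => exists n (x : S_ n), B = lam n x) A
    & forall (T : osys R) (rho : forall n, {linear S_ n -> T}),
        os_complete T ->
        (forall n, ucp (rho n)) ->
        (forall n x, rho n x = rho n.+1 (u n x)) ->
        exists f : {linear S -> T},
          [/\ ucp f, forall n x, f (lam n x) = rho n x
            & forall g : {linear S -> T}, ucp g ->
                (forall n x, g (lam n x) = rho n x) -> g =1 f]].

(* Main.v *)
Require Import Defs.
From HB Require Import structures.
From mathcomp Require Import all_boot all_order all_algebra.
From mathcomp Require Import all_classical all_reals all_analysis.
From mathcomp Require Import complex mxtens ring.

(** Every c-positive matrix over [S (x) T] is min-positive, for any [S] and [T]:
    two matrix-valued maps [phi] and [psi] act on the Hilbert space of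
    rectangular matrices by left and right multiplication, these actions
    commute, and their product map is [phi (x) psi] ([c_tensor_min]).

    For the converse on an inductive limit, let [w] be min-positive over
    [S (x) T] and let [phi], [psi] be commuting completely positive maps.  Each
    entry of [w] is a finite sum of elementary tensors, so density lets one
    replace its first legs by elements of some [S_ N]; this gives a matrix [v]
    over [S_ N (x) T] whose images under product maps are close to those of [w],
    uniformly over all pairs of maps whose values at the unit are bounded by a
    given constant ([tensor_approx]).  Two things are then needed.

    First, [v] plus a small multiple of the unit has to be min-positive over
    [S_ N (x) T], where [S_ N] has more matrix-valued maps to test against than
    those visibly coming from [S].  Each unital completely positive map from
    [S_ N] to matrices extends along the embedding into [S]
    ([ucp_mat_extension]): such a map is the same as a positive functional on
    matrices over [S_ N], and positive functionals extend by a Zorn argument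
    ([positive_extension]).  Hence the tests over [S_ N] are tests of [w] up to a
    small error.  Nuclearity of [S_ N] then makes the perturbed [v] c-positive,
    and letting the error tend to zero bounds the form of [w] from below.

    Second, positivity of a complex number includes being real, while the
    approximants are not self-adjoint.  The approximation is therefore applied
    to the sum of [v] and its adjoint, which controls only the real part of the
    form of [w] ([min_tensor_real_part]).  The imaginary part is recovered by
    the same result: with [w'] the adjoint of [w], the multiples of [w - w'] by
    the imaginary unit and by its opposite vanish under all matrix-valued tests,
    so both are min-positive, and this forces the form of [w] to be real
    ([min_tensor_c]). *)

Set Implicit Arguments.
Unset Strict Implicit.
Unset Printing Implicit Defensive.

Import Order.TTheory GRing.Theory Num.Theory.
Import numFieldNormedType.Exports.

Local Open Scope ring_scope.

(** * Complex numbers *)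

(** Polarization: the phases 1 and -1 bound the sum [p + q] by [E], the phases
    [i] and [-i] bound [i (p - q)], and both combinations come out real because
    nonnegative complex numbers are. *)
Lemma four_phase (C : numClosedFieldType) (E p q : C) :
  (forall z : C, `|z| = 1 -> 0 <= E + z * p + z^* * q) -> q = p^* /\ `|p| <= E.
Proof.
move=> pos.
have a1 : 0 <= E + (p + q) by have := pos 1 (normr1 C); rewrite conjC1 !mul1r addrA.
have a2 : 0 <= E - (p + q).
  by have := pos (-1) (normrN1 C); rewrite rmorphN rmorph1 !mulN1r opprD addrA.
have b1 : 0 <= E + 'i * (p - q).
  by have := pos 'i (normCi C); rewrite conjCi mulNr mulrBr addrA.
have b2 : 0 <= E - 'i * (p - q).
  have := pos (- 'i); rewrite normrN rmorphN /= conjCi opprK mulrBr => /(_ (normCi C)).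
  by rewrite mulNr opprB addrA addrAC.
have E0 : 0 <= E.
  have := addr_ge0 a1 a2; rewrite addrACA subrr addr0 -mulr2n.
  by rewrite pmulrn_lge0.
have aR : p + q \is Num.real.
  by rewrite -(rpredDl _ (ger0_real E0)); exact: ger0_real.
have bR : 'i * (p - q) \is Num.real.
  by rewrite -(rpredDl _ (ger0_real E0)); exact: ger0_real.
have pE : p *+ 2 = (p + q) - 'i * ('i * (p - q)).
  by rewrite mulrA -expr2 sqrCi mulN1r opprK addrACA subrr addr0 mulr2n.
have qE : q *+ 2 = (p + q) + 'i * ('i * (p - q)).
  by rewrite mulrA -expr2 sqrCi mulN1r opprB addrC addrA subrK mulr2n.
split.
  apply: (@mulIf _ 2); first by rewrite pnatr_eq0.
  rewrite -[RHS](conjCK) rmorphM /= conjCK conjC_nat !mulr_natr qE pE.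
  rewrite rmorphB rmorphM /= conjCi mulNr opprK.
  by rewrite (CrealP aR) (CrealP bR).
rewrite -(@ler_pMn2r _ 2) // -normrMn pE (le_trans (ler_normB _ _)) //.
rewrite normrM normCi mul1r mulr2n lerD //; rewrite real_ler_norml //.
  by apply/andP; split; rewrite -subr_ge0 ?opprK // addrC.
by apply/andP; split; rewrite -subr_ge0 ?opprK // addrC.
Qed.

Section ComplexEstimates.
Variable C : numClosedFieldType.
Implicit Types a d z : C.

Lemma add_conj_real z : z + z^* \is Num.real.
Proof. by apply/CrealP; rewrite rmorphD /= conjCK addrC. Qed.

Lemma add_conj_ge z e : `|z| <= e -> 0 <= z + z^* + 2 * e.
Proof.
move=> ze; have : `|z + z^*| <= 2 * e.
  by rewrite (le_trans (ler_normD _ _)) // norm_conjC mulr2n mulrDl mul1r lerD.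
by rewrite real_ler_norml ?add_conj_real // => /andP[+ _]; rewrite -subr_ge0 opprK.
Qed.

(** Letting the perturbation [d] tend to zero; [z] may be any complex number,
    so no sign of the error term has to be known in advance. *)
Lemma real_ge0_of_perturbation a z : a \is Num.real ->
  (forall d, 0 < d -> 0 <= a + d * z) -> 0 <= a.
Proof.
move=> aR pert; have [//|a0] := real_leP (real0 C) aR.
have z1 : 0 < `|z| + 1 by rewrite ltr_wpDl.
have d0 : 0 < - a / (`|z| + 1) by rewrite divr_gt0 ?oppr_gt0.
have := pert _ d0; set d := _ / _ in d0 *.
rewrite -[a]opprK addrC subr_ge0 => le.
have : `|d * z| < - a.
  by rewrite normrM gtr0_norm // /d mulrAC ltr_pdivrMr // ltr_pM2l ?oppr_gt0 // ltrDl.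
by rewrite ger0_norm ?(le_trans _ le) ?oppr_ge0 ?(ltW a0) // => /(le_lt_trans le); rewrite ltxx.
Qed.
End ComplexEstimates.

Lemma complex_norm_real (R : realType) (r : R) : `|r%:C%C| = `|r|%:C%C.
Proof. by rewrite normc_def /= expr0n addr0 sqrtr_sqr. Qed.

Lemma complex_gt0E (R : realType) (e : R[i]) :
  0 < e -> 0 < complex.Re e /\ e = (complex.Re e)%:C%C.
Proof.
case: e => a b; rewrite ltcE /= => /andP[/eqP -> a0]; split=> //.
Qed.

Lemma complex_norm_le (R : realType) (z : R[i]) :
  `|z| <= (`|complex.Re z| + `|complex.Im z|)%:C%C.
Proof.
rewrite {1}(complexE z) (le_trans (ler_normD _ _)) // normrM !complex_norm_real.
by rewrite normc_def /= expr0n expr1n add0r sqrtr1 mul1r -rmorphD.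
Qed.

Lemma complex_norm_ge_Im (R : realType) (z : R[i]) : `|complex.Im z|%:C%C <= `|z|.
Proof.
case: z => a b; rewrite normc_def lecR /= -sqrtr_sqr ler_wsqrtr //.
by rewrite lerDr sqr_ge0.
Qed.

Section ComplexParts.
Variable R : realType.
Implicit Types z : R[i].

Lemma complex_Re_conj z : complex.Re z^* = complex.Re z.
Proof. by apply: complexI; rewrite !complexRe Re_conj. Qed.

Lemma complex_ReD z w : complex.Re (z + w) = complex.Re z + complex.Re w.
Proof. exact: raddfD. Qed.

Lemma complex_Re_real (a : R) z : complex.Re (a%:C%C * z) = a * complex.Re z.
Proof. by case: z => x y /=; rewrite mul0r subr0. Qed.

Lemma complex_Re_ge0 z : 0 <= z -> 0 <= complex.Re z.
Proof. by rewrite lecE => /andP[]. Qed.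

Lemma complex_Re_le z (w : R[i]) : `|z| <= w -> complex.Re z <= complex.Re w.
Proof.
move=> zw; rewrite -lecR (RRe_real (ger0_real (le_trans (normr_ge0 z) zw))).
apply: le_trans zw; apply: le_trans (normc_ge_Re z).
by rewrite lecR ler_norm.
Qed.
End ComplexParts.

(** * Inner products and bounded operators *)

Section InnerProduct.
Variables (R : realType) (H : hilbert R).
Implicit Types x y z : H.

Lemma ipC x y : ip H x y = (ip H y x)^*.
Proof. by rewrite hermC /= expr0 mul1r. Qed.
Lemma ipDl x y z : ip H (x + y) z = ip H x z + ip H y z.
Proof. exact: linearDl. Qed.
Lemma ipZl (c : R[i]) x z : ip H (c *: x) z = c * ip H x z.
Proof. exact: linearZl_LR. Qed.
Lemma ipDr z x y : ip H z (x + y) = ip H z x + ip H z y.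
Proof. by rewrite ipC ipDl rmorphD /= -!ipC. Qed.
Lemma ipZr (c : R[i]) z x : ip H z (c *: x) = c^* * ip H z x.
Proof. by rewrite ipC ipZl rmorphM /= -ipC. Qed.
Lemma ipNl x z : ip H (- x) z = - ip H x z.
Proof. by rewrite -scaleN1r ipZl mulN1r. Qed.
Lemma ip0l z : ip H 0 z = 0.
Proof. by rewrite -(scale0r 0) ipZl mul0r. Qed.
Lemma ip_ge0 x : 0 <= ip H x x.
Proof. by rewrite ip_norm exprn_ge0. Qed.

(** A weak Cauchy-Schwarz inequality, which avoids square roots and suffices
    for every continuity argument below. *)
Lemma ip_le x y : `|ip H x y| <= `|x| ^+ 2 + `|y| ^+ 2.
Proof.
apply: (proj2 (@four_phase _ _ _ (ip H y x) _)) => z z1.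
have := ip_ge0 (z *: x + y); rewrite ipDl !ipDr !ipZl !ipZr.
rewrite mulrA -normCK z1 expr1n mul1r !ip_norm.
by congr (0 <= _); rewrite mulrC; ring.
Qed.

Lemma bop_addE (A B : bop H) x : (A + B) x = A x + B x. Proof. by []. Qed.
Lemma bop_scaleE c (A : bop H) x : (c *: A) x = c *: A x. Proof. by []. Qed.
Lemma bop_oppE (A : bop H) x : (- A) x = - A x. Proof. by []. Qed.

Lemma bopD (A : bop H) x y : A (x + y) = A x + A y.
Proof.
by case: A => A /= /asboolP[lA _]; rewrite -[x in LHS]scale1r lA scale1r.
Qed.

Lemma bop0 (A : bop H) : A 0 = 0.
Proof. by apply: (addrI (A 0)); rewrite -bopD !addr0. Qed.

Lemma bopZ (A : bop H) c x : A (c *: x) = c *: A x.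
Proof.
by case: A (bop0 A) => A /= /asboolP[lA _] A0; rewrite -[c *: x]addr0 lA A0 addr0.
Qed.

Lemma bop_bounded (A : bop H) : exists2 e : R[i], 0 < e & op_norm_le A e.
Proof.
have /asboolP[_ [M bA]] := bop_funP A.
exists (`|M| + 1) => [|x /=]; first by rewrite ltr_wpDl.
have Mx : 0 <= M * `|x| := le_trans (normr_ge0 _) (bA x).
rewrite (le_trans (bA x)) // -(ger0_norm Mx) normrM normr_id.
by rewrite mulrDl lerDl mul1r.
Qed.

End InnerProduct.

Section BopForm.
Variables (R : realType) (H : hilbert R) (k : nat).

(** The quadratic form of an operator matrix acting on [H^k]; the cones of
    operator matrices are defined by its sign. *)
Definition bop_form (A : 'I_k -> 'I_k -> bop H) (x : 'I_k -> H) : R[i] :=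
  \sum_i \sum_j ip H (A i j (x j)) (x i).

Lemma bop_formD A B x : bop_form (A + B) x = bop_form A x + bop_form B x.
Proof.
rewrite /bop_form -big_split; apply: eq_bigr => i _.
by rewrite -big_split; apply: eq_bigr => j _; exact: ipDl.
Qed.

Lemma bop_formZ c A x : bop_form (c *: A) x = c * bop_form A x.
Proof.
rewrite /bop_form mulr_sumr; apply: eq_bigr => i _.
by rewrite mulr_sumr; apply: eq_bigr => j _; exact: ipZl.
Qed.

Lemma bop_form_adjoint (A B : 'I_k -> 'I_k -> bop H) (x : 'I_k -> H) :
  (forall i j x y, ip H (B i j x) y = (ip H (A j i y) x)^*) ->
  bop_form B x = (bop_form A x)^*.
Proof.
move=> AB; rewrite /bop_form rmorph_sum /= exchange_big; apply: eq_bigr => i _.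
by rewrite rmorph_sum; apply: eq_bigr => j _; exact: AB.
Qed.

Lemma bop_form_bounded A : exists2 c : R[i], 0 <= c &
  forall x, `|bop_form A x| <= c * \sum_i `|x i| ^+ 2.
Proof.
have bA ij : exists e : R[i], 0 < e /\ op_norm_le (A ij.1 ij.2) e.
  by have [e e0 Ae] := bop_bounded (A ij.1 ij.2); exists e.
have [e he] := choice bA.
exists (\sum_i \sum_j (e (i, j) ^+ 2 + 1)) => [|x].
  by rewrite !sumr_ge0 // => i _; rewrite sumr_ge0 // => j _;
    rewrite addr_ge0 // exprn_ge0 // ltW //; have [] := he (i, j).
have xi_le i : `|x i| ^+ 2 <= \sum_l `|x l| ^+ 2.
  by rewrite (bigD1 i) //= lerDl sumr_ge0 // => l _; rewrite exprn_ge0.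
rewrite mulr_suml (le_trans (ler_norm_sum _ _ _)) //; apply: ler_sum => i _.
rewrite mulr_suml (le_trans (ler_norm_sum _ _ _)) //; apply: ler_sum => j _.
have [e0 Ae] := he (i, j).
rewrite (le_trans (ip_le _ _)) // mulrDl mul1r lerD //.
rewrite (le_trans (_ : _ <= (e (i, j) * `|x j|) ^+ 2)) //.
  by rewrite lerXn2r ?nnegrE // ?mulr_ge0 ?(ltW e0) //; exact: Ae.
by rewrite exprMn ler_wpM2l // exprn_ge0 // ltW.
Qed.

Lemma bop_form_close (X Y : 'I_k -> 'I_k -> bop H) (M : R[i]) (x : 'I_k -> H) :
  (forall i j a b, `|ip H (X i j a) b - ip H (Y i j a) b| <=
     M * (`|a| ^+ 2 + `|b| ^+ 2)) ->
  `|bop_form X x - bop_form Y x| <= M * (2 * k%:R * \sum_i `|x i| ^+ 2).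
Proof.
move=> XY; have -> : M * (2 * k%:R * \sum_i `|x i| ^+ 2) =
    \sum_i \sum_j M * (`|x j| ^+ 2 + `|x i| ^+ 2).
  have -> : \sum_(i < k) \sum_(j < k) M * (`|x j| ^+ 2 + `|x i| ^+ 2) =
      \sum_(i < k) (M * (\sum_j `|x j| ^+ 2) + M * (k%:R * `|x i| ^+ 2)).
    apply: eq_bigr => i _; rewrite -mulr_sumr big_split sumr_const card_ord /=.
    by rewrite mulrDr mulr_natl.
  rewrite big_split /= sumr_const card_ord -mulr_sumr -mulr_sumr -mulr_natl.
  by ring.
rewrite /bop_form -sumrB (le_trans (ler_norm_sum _ _ _)) //; apply: ler_sum => i _.
rewrite -sumrB (le_trans (ler_norm_sum _ _ _)) //; apply: ler_sum => j _.
exact: XY.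
Qed.

End BopForm.

(** * The Hilbert space of rectangular matrices *)

Section HilbertSchmidt.
Variables (R : realType) (k m : nat).
Local Notation C := R[i].

(** Rectangular matrices with the Hilbert-Schmidt inner product.  The tensor
    product of [C^k] and [C^m] is modelled in this way rather than by column
    vectors of length [k * m] so that its two legs become left and right
    multiplication, which commute by associativity.  A fresh name is needed
    because matrices already carry the supremum norm. *)
Definition hs_space : Type := 'M[C]_(k, m).
HB.instance Definition _ := GRing.Lmodule.on hs_space.
HB.instance Definition _ := Vector.copy hs_space 'M[C]_(k, m).

Definition hs_ip (X Y : hs_space) : C := \sum_a \sum_b X a b * (Y a b)^*.

Lemma hs_ip_bilinear : bilinear_for *%R (Num.conj \; *%R) hs_ip.
Proof.
split=> [Y c X X'|X c Y Y']; rewrite /hs_ip /= mulr_sumr -big_split /=;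
  apply: eq_bigr => a _; rewrite mulr_sumr -big_split /=;
  apply: eq_bigr => b _; rewrite !mxE.
  by rewrite mulrDl mulrA.
by rewrite rmorphD rmorphM mulrDr mulrCA.
Qed.

HB.instance Definition _ := bilinear_isBilinear.Build C hs_space hs_space C
  *%R (Num.conj \; *%R) hs_ip hs_ip_bilinear.

Lemma hs_ip_hermitian (X Y : hs_space) :
  hs_ip X Y = (-1) ^+ false * (hs_ip Y X)^*.
Proof.
rewrite expr0 mul1r /hs_ip rmorph_sum; apply: eq_bigr => a _.
rewrite rmorph_sum; apply: eq_bigr => b _.
by rewrite rmorphM /= conjCK mulrC.
Qed.

HB.instance Definition _ := isHermitianSesquilinear.Build C hs_space false
  Num.conj hs_ip hs_ip_hermitian.

Lemma hs_ipE (X : hs_space) : hs_ip X X = \sum_a \sum_b `|X a b| ^+ 2.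
Proof. by do 2![apply: eq_bigr => ? _]; rewrite normCK. Qed.

Lemma hs_entry_le (X : hs_space) a b : `|X a b| ^+ 2 <= hs_ip X X.
Proof.
rewrite hs_ipE (bigD1 a) //= (bigD1 b) //= -addrA lerDl.
by rewrite addr_ge0 // !sumr_ge0 // => *; rewrite ?sumr_ge0 // => *; rewrite exprn_ge0.
Qed.

Lemma hs_ip_gt0 (X : hs_space) : X != 0 -> 0 < hs_ip X X.
Proof.
move=> X0; rewrite lt_def andbC.
have -> : 0 <= hs_ip X X.
  by rewrite hs_ipE !sumr_ge0 // => *; rewrite ?sumr_ge0 // => *; rewrite exprn_ge0.
apply: contra X0 => /eqP XX; apply/eqP/matrixP => a b; rewrite mxE.
apply/normr0_eq0/eqP; rewrite -sqrf_eq0 eq_le exprn_ge0 // andbT -XX.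
exact: hs_entry_le.
Qed.

HB.instance Definition _ := isDotProduct.Build C hs_space hs_ip hs_ip_gt0.

Definition hs_dot : {dot hs_space for Num.conj} := hs_ip.

Definition hs_norm (X : hs_space) : C := sqrtC (hs_dot X X).

Lemma hs_normD X Y : hs_norm (X + Y) <= hs_norm X + hs_norm Y.
Proof. exact: (triangle_lerif hs_dot X Y). Qed.

Lemma hs_normZ (c : C) X : hs_norm (c *: X) = `|c| * hs_norm X.
Proof.
rewrite /hs_norm dnormZ sqrtCM ?nnegrE ?exprn_ge0 ?dnorm_ge0 //.
by rewrite sqrCK.
Qed.

Lemma hs_norm0_eq0 X : hs_norm X = 0 -> X = 0.
Proof. by move/eqP; rewrite sqrt_dnorm_eq0 => /eqP. Qed.

HB.instance Definition _ := Lmodule_isNormed.Build C hs_space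
  hs_normD hs_normZ hs_norm0_eq0.

Lemma hs_ip_norm (X : hs_space) : hs_dot X X = `|X| ^+ 2.
Proof. by rewrite [`|X|]/(hs_norm X) sqrtCK. Qed.

End HilbertSchmidt.

Section HSComplete.
Local Open Scope classical_set_scope.
Variables (R : realType) (k m : nat).
Local Notation HS := (hs_space R k m).

Lemma hs_entry_norm (X : HS) a b : `|X a b| <= `|X|.
Proof. by rewrite -(@ler_pXn2r _ 2) ?nnegrE // -hs_ip_norm; exact: hs_entry_le. Qed.

Definition hs_delta a b : HS := delta_mx a b.

Lemma hs_norm_le_sum (X : HS) :
  `|X| <= \sum_a \sum_b `|X a b| * `|hs_delta a b|.
Proof.
have {1}-> : X = \sum_a \sum_b X a b *: hs_delta a b.
  exact: (matrix_sum_delta (X : 'M[R[i]]_(k, m))).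
apply: (le_trans (ler_norm_sum _ _ _)); apply: ler_sum => a _.
apply: (le_trans (ler_norm_sum _ _ _)); apply: ler_sum => b _.
by rewrite normrZ.
Qed.

(** The real and imaginary parts of the entries are contractive coordinates,
    hence converge, and finitely many coordinates control the norm. *)
Lemma hs_complete (F : set_system HS) :
  ProperFilter F -> cauchy F -> cvg F.
Proof.
move=> FF /cauchy_ballP Fc.
(* A contractive real coordinate maps Cauchy filters to Cauchy filters. *)
have cvgp (p : HS -> R) : (forall X, `|p X|%:C%C <= `|X|) ->
    (forall X Y, p (X - Y) = p X - p Y) -> exists l : R, p @ F --> l.
  move=> ple pB; apply/cvg_ex/(R_complete (F := p @ F))/cauchy_ballP => e e0.
  rewrite near_map2.
  have : 0 < e%:C%C by rewrite ltcR.
  move=> /Fc; apply: filterS => -[X Y]; rewrite -!ball_normE /= -ltcR.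
  by apply: le_lt_trans; rewrite -pB; exact: ple.
have cRe (ab : 'I_k * 'I_m) :
    exists l : R, (fun X : HS => complex.Re (X ab.1 ab.2)) @ F --> l.
  apply: cvgp => [X|X Y]; last by rewrite !mxE raddfB.
  exact: le_trans (normc_ge_Re _) (hs_entry_norm _ _ _).
have cIm (ab : 'I_k * 'I_m) :
    exists l : R, (fun X : HS => complex.Im (X ab.1 ab.2)) @ F --> l.
  apply: cvgp => [X|X Y]; last by rewrite !mxE raddfB.
  exact: le_trans (complex_norm_ge_Im _) (hs_entry_norm _ _ _).
have [r cr] := choice cRe; have [s cs] := choice cIm.
pose L : HS := \matrix_(a, b) (r (a, b) +i* s (a, b))%C.
apply/cvg_ex; exists L; apply/cvgrPdist_lt => e /complex_gt0E[].
move: (complex.Re e) => e' e0 ->{e}.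
(* The factor 2 accounts for the real and imaginary parts, and the summand 1
   makes [K] positive when there are no entries. *)
pose K := 1 + \sum_a \sum_b (complex.Re `|hs_delta a b| *+ 2).
have delta_ge0 a b : 0 <= complex.Re `|hs_delta a b|.
  by have := normr_ge0 (hs_delta a b); rewrite lecE => /andP[].
have K0 : 0 < K.
  rewrite ltr_pwDl // sumr_ge0 // => a _; rewrite sumr_ge0 // => b _.
  by rewrite mulrn_wge0.
have eK : 0 < e' / K by rewrite divr_gt0.
have nearL : \forall X \near F, forall ab : 'I_k * 'I_m,
    `|r ab - complex.Re ((X : HS) ab.1 ab.2)| < e' / K /\
    `|s ab - complex.Im (X ab.1 ab.2)| < e' / K.
  apply: filter_forall => ab; near=> X; split; near: X.
  - by move/cvgrPdist_lt: (cr ab); apply.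
  - by move/cvgrPdist_lt: (cs ab); apply.
apply: filterS nearL => X nX.
have entry a b : `|(L - X) a b| <= ((e' / K) *+ 2)%:C%C.
  apply: (le_trans (complex_norm_le _)); rewrite lecR mulr2n !mxE !raddfB /=.
  by have [/ltW ? /ltW ?] := nX (a, b); exact: lerD.
apply: (le_lt_trans (hs_norm_le_sum _)).
have deltaE a b : `|hs_delta a b| = (complex.Re `|hs_delta a b|)%:C%C.
  by rewrite RRe_real // normr_real.
apply: (@le_lt_trans _ _ (\sum_a \sum_b (e' / K * (complex.Re `|hs_delta a b| *+ 2))%:C%C)).
  apply: ler_sum => a _; apply: ler_sum => b _.
  rewrite mulrnAr -mulrnAl rmorphM /= -deltaE.
  by rewrite ler_wpM2r.
under eq_bigr do rewrite -rmorph_sum; rewrite -rmorph_sum /= ltcR.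
under eq_bigr do rewrite -mulr_sumr; rewrite -mulr_sumr.
rewrite -mulrA gtr_pMr // mulrC ltr_pdivrMr // mul1r.
by rewrite /K ltrDr.
Unshelve. all: by end_near. Qed.

HB.instance Definition _ := Uniform_isComplete.Build HS hs_complete.

Definition hs_hilbert : hilbert R :=
  @Hilbert R HS (@hs_dot R k m) (@hs_ip_norm R k m).
End HSComplete.

(** * Algebraic tensor products *)

Section TensorDecomp.
Variables (K : comNzRingType) (U V : lmodType K).

Lemma tensor_decomp (x : tensor U V) :
  exists s : seq (U * V), x = \sum_(p <- s) tens p.1 p.2.
Proof.
exists (repr x); apply: tensorP => W f; rewrite raddf_sum /=.
by under eq_bigr do rewrite tensor_lift_tens.
Qed.

Lemma tensor_ind (P : tensor U V -> Prop) :
  P 0 -> (forall x y, P x -> P y -> P (x + y)) -> (forall u v, P (tens u v)) ->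
  forall x, P x.
Proof.
move=> P0 PD Pt x; have [s ->] := tensor_decomp x.
by apply: (big_ind P) => // *; exact: Pt.
Qed.
End TensorDecomp.

HB.instance Definition _ (R : realType) (S T : osys R) (H : hilbert R)
    (phi : {linear S -> bop H}) (psi : {linear T -> bop H}) :=
  GRing.isLinear.Build R[i] (tensor S T) (bop H) *:%R (product_map phi psi)
    (tensor_lift_linear (comp_form phi psi)).

HB.instance Definition _ (R : realType) (S T : osys R) (k m : nat)
    (phi : {linear S -> 'M[R[i]]_k}) (psi : {linear T -> 'M[R[i]]_m}) :=
  GRing.isLinear.Build R[i] (tensor S T) 'M[R[i]]_(k * m) *:%R
    (tensor_map phi psi) (tensor_lift_linear (kron_form phi psi)).

Section Tensors.
Variables (R : realType) (S T : osys R) (H : hilbert R).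

Lemma product_map_restrict (S' : osys R) (lam : {linear S' -> S})
    (phi : {linear S -> bop H}) (psi : {linear T -> bop H}) (s : S') (t : T) :
  product_map (phi \o lam : {linear S' -> bop H}) psi (tens s t) =
  product_map phi psi (tens (lam s) t).
Proof. by rewrite !product_map_tens. Qed.

Lemma eq_product_map (phi phi' : {linear S -> bop H}) (psi : {linear T -> bop H})
  (w : tensor S T) : phi =1 phi' -> product_map phi psi w = product_map phi' psi w.
Proof.
move=> eq_phi; elim/tensor_ind: w => [|w w' IH IH'|s t].
- by rewrite !linear0.
- by rewrite !linearD /= IH IH'.
by rewrite !product_map_tens eq_phi.
Qed.

Definition commuting (phi : {linear S -> bop H}) (psi : {linear T -> bop H}) :=
  forall s t, bop_comp (phi s) (psi t) = bop_comp (psi t) (phi s).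
End Tensors.

(** * Pairs of matrix-valued maps as commuting operator-valued maps *)

Section HSOperators.
Variables (R : realType) (k m : nat).
Local Notation HS := (hs_space R k m).
Local Notation H := (hs_hilbert R k m).

(** A linear map is bounded by the sum of the norms of its values at the
    matrix units. *)
Lemma hs_linear_bounded (L : HS -> HS) : linear L -> L \in @bounded_op R H.
Proof.
move=> linL; apply/asboolP; split=> //.
have LD : {morph L : X Y / X + Y}.
  by move=> X Y; rewrite -[X in X + _]scale1r linL scale1r.
have L0 : L 0 = 0 by apply: (addrI (L 0)); rewrite -LD !addr0.
have LZ c X : L (c *: X) = c *: L X by rewrite -[c *: X]addr0 linL L0 addr0.
exists (\sum_a \sum_b `|L (hs_delta R a b)|) => X.
have {1}-> : (X : HS) = \sum_a \sum_b (X : HS) a b *: hs_delta R a b.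
  exact: (matrix_sum_delta (X : 'M[R[i]]_(k, m))).
rewrite (big_morph L LD L0) mulr_suml.
apply: (le_trans (ler_norm_sum _ _ _)); apply: ler_sum => a _.
rewrite (big_morph L LD L0) mulr_suml.
apply: (le_trans (ler_norm_sum _ _ _)); apply: ler_sum => b _.
by rewrite LZ normrZ mulrC ler_wpM2l // hs_entry_norm.
Qed.

Lemma hs_lmul_bounded (A : 'M[R[i]]_k) :
  ((fun X => A *m X) : HS -> HS) \in @bounded_op R H.
Proof.
by apply: hs_linear_bounded => c X Y; rewrite mulmxDr -scalemxAr.
Qed.

(** The transpose matches the convention of the Kronecker product: without it
    [B] would act as its transpose, and transposition does not preserve complete
    positivity. *)
Lemma hs_rmul_bounded (B : 'M[R[i]]_m) :
  ((fun X => X *m B^T) : HS -> HS) \in @bounded_op R H.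
Proof.
by apply: hs_linear_bounded => c X Y; rewrite mulmxDl -scalemxAl.
Qed.

Definition hs_lmul A : bop H := Bop (hs_lmul_bounded A).
Definition hs_rmul B : bop H := Bop (hs_rmul_bounded B).

Lemma hs_lmul_linear : linear hs_lmul.
Proof.
move=> c A B; apply/val_inj/funext => X /=.
by rewrite mulmxDl -scalemxAl.
Qed.

Lemma hs_rmul_linear : linear hs_rmul.
Proof.
move=> c A B; apply/val_inj/funext => X /=.
by rewrite linearP mulmxDr -scalemxAr.
Qed.

HB.instance Definition _ := GRing.isLinear.Build _ _ _ _ hs_lmul hs_lmul_linear.
HB.instance Definition _ := GRing.isLinear.Build _ _ _ _ hs_rmul hs_rmul_linear.

Lemma hs_lmul_rmulC A B :
  bop_comp (hs_lmul A) (hs_rmul B) = bop_comp (hs_rmul B) (hs_lmul A).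
Proof. by apply/val_inj/funext => X /=; rewrite mulmxA. Qed.

End HSOperators.

Section HSRepresentation.
Variables (R : realType) (k m : nat).
Local Notation HS := (hs_space R k m).
Local Notation H := (hs_hilbert R k m).

Definition hs_left (S : osys R) (phi : {linear S -> 'M[R[i]]_k}) :
  {linear S -> bop H} := @hs_lmul R k m \o phi.
Definition hs_right (T : osys R) (psi : {linear T -> 'M[R[i]]_m}) :
  {linear T -> bop H} := @hs_rmul R k m \o psi.

Lemma hs_ipH (X Y : H) :
  ip H X Y = \sum_a \sum_b (X : HS) a b * ((Y : HS) a b)^*.
Proof. by []. Qed.

Lemma mat_formE n (A : 'M[R[i]]_n) (x y : 'cV[R[i]]_n) :
  ((map_mx Num.conj y)^T *m A *m x) 0 0 =
  \sum_a \sum_c (A a c * x c 0) * (y a 0)^*.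
Proof.
rewrite -mulmxA mxE; apply: eq_bigr => a _; rewrite !mxE mulr_sumr.
by apply: eq_bigr => c _; rewrite mulrC.
Qed.

(** Left multiplication acts on each column separately, so the form of the
    amplified map is the sum, over the columns, of forms of [phi]. *)
Lemma hs_left_cp (S : osys R) (phi : {linear S -> 'M[R[i]]_k}) :
  ucp_mat phi -> cp_bop (hs_left phi).
Proof.
move=> [_ cpphi] n A /cpphi posA x.
have -> : \sum_i \sum_j ip H ((map_mx (hs_left phi) A) i j (x j)) (x i) =
  \sum_b (\sum_i \sum_j (map_mx Num.conj (col b (x i : HS)))^T *m
     map_mx phi A i j *m col b (x j : HS)) 0 0.
  under [RHS]eq_bigr do rewrite summxE; rewrite [RHS]exchange_big.
  apply: eq_bigr => i _; under [RHS]eq_bigr do rewrite summxE.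
  rewrite [RHS]exchange_big. apply: eq_bigr => j _.
  under [RHS]eq_bigr do rewrite mat_formE.
  rewrite [RHS]exchange_big hs_ipH; apply: eq_bigr => a _; apply: eq_bigr => b _.
  by rewrite !mxE mulr_suml; apply: eq_bigr => c _; rewrite !mxE.
by rewrite sumr_ge0 // => b _; exact: posA.
Qed.

(** Symmetrically, the rows are the invariant summands. *)
Lemma hs_right_cp (T : osys R) (psi : {linear T -> 'M[R[i]]_m}) :
  ucp_mat psi -> cp_bop (hs_right psi).
Proof.
move=> [_ cppsi] n A /cppsi posA x.
have -> : \sum_i \sum_j ip H ((map_mx (hs_right psi) A) i j (x j)) (x i) =
  \sum_a (\sum_i \sum_j (map_mx Num.conj (row a (x i : HS))^T)^T *m
     map_mx psi A i j *m (row a (x j : HS))^T) 0 0.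
  under [RHS]eq_bigr do rewrite summxE; rewrite [RHS]exchange_big.
  apply: eq_bigr => i _; under [RHS]eq_bigr do rewrite summxE.
  rewrite [RHS]exchange_big. apply: eq_bigr => j _.
  rewrite hs_ipH; apply: eq_bigr => a _; rewrite mat_formE.
  apply: eq_bigr => b _.
  rewrite !mxE mulr_suml; apply: eq_bigr => c _; rewrite !mxE.
  by rewrite [_ * psi _ _ _]mulrC.
by rewrite sumr_ge0 // => b _; exact: posA.
Qed.

Lemma hs_left1 (S : osys R) (phi : {linear S -> 'M[R[i]]_k}) :
  ucp_mat phi -> hs_left phi (os_one S) = bop_id H.
Proof.
by move=> [phi1 _]; apply/val_inj/funext => X /=; rewrite phi1 mul1mx.
Qed.

Lemma hs_right1 (T : osys R) (psi : {linear T -> 'M[R[i]]_m}) :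
  ucp_mat psi -> hs_right psi (os_one T) = bop_id H.
Proof.
by move=> [psi1 _]; apply/val_inj/funext => X /=; rewrite psi1 trmx1 mulmx1.
Qed.

Definition hs_vec (X : HS) : 'cV[R[i]]_(k * m) :=
  \col_p X (mxtens_unindex p).1 (mxtens_unindex p).2.
Definition hs_unvec (x : 'cV[R[i]]_(k * m)) : HS :=
  \matrix_(a, b) x (mxtens_index (a, b)) 0.

Lemma hs_unvecK : cancel hs_unvec hs_vec.
Proof.
move=> x; apply/matrixP => p j; rewrite !mxE ord1 -surjective_pairing.
by rewrite mxtens_unindexK.
Qed.

(** Row-major vectorization turns the map [X |-> A X B^T] into the Kronecker
    product of [A] and [B]; hence the product of the two commuting
    representations is unitarily equivalent to [phi (x) psi]. *)
Lemma hs_product_form (S T : osys R) (phi : {linear S -> 'M[R[i]]_k})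
    (psi : {linear T -> 'M[R[i]]_m}) (w : tensor S T) (X Y : H) :
  ip H (product_map (hs_left phi) (hs_right psi) w X) Y =
  ((map_mx Num.conj (hs_vec Y))^T *m tensor_map phi psi w *m hs_vec X) 0 0.
Proof.
elim/tensor_ind: w => [|w w' IH IH'|s t].
- have -> : tensor_map phi psi 0 = 0 by exact: linear0.
  by rewrite linear0 mulmx0 mul0mx mxE linear0l.
- have -> : tensor_map phi psi (w + w') = tensor_map phi psi w + tensor_map phi psi w'.
    exact: linearD.
  by rewrite linearD mulmxDr mulmxDl [RHS]mxE -IH -IH' -linearDl.
have unindex_bij (P : pred 'I_(k * m)) : {on P, bijective (@mxtens_index k m)}.
  exists (@mxtens_unindex k m) => p _; [exact: mxtens_indexK|exact: mxtens_unindexK].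
rewrite product_map_tens tensor_map_tens hs_ipH mat_formE.
rewrite pair_bigA [RHS](reindex (@mxtens_index k m)) /=; last exact: unindex_bij.
apply: eq_bigr => -[a b] _ /=.
rewrite [RHS](reindex (@mxtens_index k m)) /=; last exact: unindex_bij.
transitivity (\sum_c \sum_d phi s a c * (X : HS) c d * psi t b d * ((Y : HS) a b)^*).
  rewrite !mxE mulr_suml; apply: eq_bigr => c _.
  rewrite !mxE mulr_sumr mulr_suml; apply: eq_bigr => d _.
  by rewrite mxE mulrA.
rewrite pair_bigA; apply: eq_bigr => -[c d] _ /=.
rewrite tensmxE !mxE !mxtens_indexK /=; congr (_ * _).
by rewrite mulrAC.
Qed.

End HSRepresentation.

Lemma hs_commuting (R : realType) (S T : osys R) k m (phi : {linear S -> 'M[R[i]]_k})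
    (psi : {linear T -> 'M[R[i]]_m}) : commuting (hs_left m phi) (hs_right k psi).
Proof. by move=> s t; exact: hs_lmul_rmulC. Qed.

(** * Completely positive maps *)

Section CompletelyPositive.
Variables (R : realType) (S : osys R) (H : hilbert R).

(** The classical fact that the operator matrix with diagonal [e] and
    off-diagonal entries [s], [s'] is positive when [s] has norm at most [e].
    Up to the factor [e], its form is the squared norm of [e z + s y] plus
    the nonnegative [e^2 |y|^2 - |s y|^2]. *)
Lemma osys_two_by_two_pos (s s' : S) (e : R[i]) :
  adjoint_of s s' -> 0 < e -> op_norm_le s e ->
  os_mx_pos (\matrix_(i < 2, j < 2)
    (if i == j then e *: os_one S else if i < j then s else s')%N).
Proof.
move=> ss' e0 se x; rewrite !(big_ord_recl, big_ord0) /= !mxE /=.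
set y := x (lift _ _); set z := x ord0; rewrite !addr0.
have eR : e^* = e by exact/CrealP/gtr0_real.
have -> : ip (os_hilb S) (s' z) y = (ip _ (s y) z)^* by rewrite ss' -ipC.
rewrite -[X in 0 <= X](mulKf (lt0r_neq0 e0)) mulr_ge0 ?invr_ge0 ?(ltW e0) //.
rewrite !ipZl !ip_norm.
have := ip_ge0 (e *: z + s y).
rewrite ipDl !ipDr !ipZl !ipZr eR !ip_norm [ip _ z _]ipC => pos.
have le : `|s y| ^+ 2 <= e ^+ 2 * `|y| ^+ 2.
  by rewrite -exprMn lerXn2r ?nnegrE // mulr_ge0 // ltW.
rewrite (le_trans pos) // -subr_ge0.
rewrite (_ : _ - _ = e ^+ 2 * `|y| ^+ 2 - `|s y| ^+ 2) ?subr_ge0 //.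
by ring.
Qed.

Lemma osys_adjoint (s : S) : exists s' : S, adjoint_of s s'.
Proof. by have [B SB sB] := os_adj (os_valP s); exists (OSElt SB). Qed.

Variable phi : {linear S -> bop H}.
Hypothesis cphi : cp_bop phi.
Local Notation one := (os_one S).

(** Applying a 2-positive map to the matrix above and rotating one of the two
    vectors by a phase puts the off-diagonal values in the situation of
    [four_phase], which gives both hermiticity and boundedness of [phi]. *)
Lemma cp_off_diagonal (s s' : S) (e : R[i]) (x y : H) :
  adjoint_of s s' -> 0 < e -> op_norm_le s e ->
  ip H (phi s' x) y = (ip H (phi s y) x)^* /\
  `|ip H (phi s y) x| <= e * (ip H (phi one x) x + ip H (phi one y) y).
Proof.
move=> ss' e0 se; apply: four_phase => z z1.
have := cphi (osys_two_by_two_pos ss' e0 se)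
  (fun i => if i == ord0 then x else z *: y).
rewrite !(big_ord_recl, big_ord0) /= !mxE /= !addr0 linearZ_LR !bop_scaleE.
rewrite !bopZ !ipZl !ipZr.
congr (0 <= _).
rewrite [z * (z^* * _)]mulrA -normCK z1 expr1n mul1r.
by ring.
Qed.

Lemma cp_adjoint (s s' : S) (x y : H) :
  adjoint_of s s' -> ip H (phi s' x) y = (ip H (phi s y) x)^*.
Proof.
move=> ss'; have [e e0 se] := bop_bounded s.
exact: (cp_off_diagonal x y ss' e0 se).1.
Qed.

Variables (c : R[i]) (c0 : 0 < c).
Hypothesis phi_c : forall x, ip H (phi one x) x <= c * `|x| ^+ 2.

Lemma cp_form_le (s : S) (e : R[i]) (x y : H) :
  0 < e -> op_norm_le s e ->
  `|ip H (phi s y) x| <= e * c * (`|x| ^+ 2 + `|y| ^+ 2).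
Proof.
move=> e0 se; have [s' ss'] := osys_adjoint s.
have [_] := cp_off_diagonal x y ss' e0 se; move/le_trans; apply.
by rewrite -mulrA ler_wpM2l ?(ltW e0) // mulrDr lerD.
Qed.

(** The form estimate at the vector [x = r (phi s y)]: for the optimal
    [r = 1 / (2 e c)] half of the term [r |phi s y|^2] survives. *)
Lemma cp_norm_le (s : S) (e : R[i]) (y : H) :
  0 < e -> op_norm_le s e -> `|phi s y| ^+ 2 <= 4 * (e * c) ^+ 2 * `|y| ^+ 2.
Proof.
move=> e0 se; set K := e * c; have K0 : 0 < K by rewrite mulr_gt0.
have r0 : 0 < (2 * K)^-1 by rewrite invr_gt0 mulr_gt0.
set r := (2 * K)^-1 in r0.
have h := cp_form_le (r *: phi s y) y e0 se.
rewrite ipZr ip_norm [X in X <= _]normrM norm_conjC (gtr0_norm r0) in h.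
rewrite ger0_norm ?exprn_ge0 // normrZ (gtr0_norm r0) exprMn -/K mulrDr in h.
set W := `|phi s y| ^+ 2 in h *; set Y := `|y| ^+ 2 in h *.
have KV : K * r = 2^-1 by rewrite /r invfM mulrCA mulfV ?mulr1 // gt_eqF.
have -> : W = 4 * K * (r * W - K * (r ^+ 2 * W)).
  have {1}-> : W = (4 * (K * r) - 4 * (K * r) ^+ 2) * W; last by ring.
  by rewrite KV; field.
have -> : 4 * K ^+ 2 * Y = 4 * K * (K * Y) by ring.
by rewrite ler_pM2l ?mulr_gt0 // lerBlDl.
Qed.

End CompletelyPositive.

Section CpBounds.
Variables (R : realType) (H : hilbert R).

Definition cp_bounded (U : osys R) (phi : {linear U -> bop H}) (c : R[i]) :=
  forall x, ip H (phi (os_one U) x) x <= c * `|x| ^+ 2.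

Lemma cp_one_ge0 (S : osys R) (phi : {linear S -> bop H}) (x : H) :
  cp_bop phi -> 0 <= ip H (phi (os_one S) x) x.
Proof.
move=> cphi; have pos1 : os_mx_pos (\matrix_(i < 1, j < 1) os_one S).
  by move=> y; rewrite !big_ord1 !mxE; exact: ip_ge0.
by have := cphi _ _ pos1 (fun=> x); rewrite !big_ord1 !mxE.
Qed.

Lemma cp_bounded_exists (S : osys R) (phi : {linear S -> bop H}) :
  cp_bop phi -> exists2 c : R[i], 0 < c & cp_bounded phi c.
Proof.
move=> cphi; have [e e0 be] := bop_bounded (phi (os_one S)).
exists (e ^+ 2 + 1) => [|x]; first by rewrite ltr_wpDl // exprn_ge0 // ltW.
rewrite -(ger0_norm (cp_one_ge0 x cphi)) (le_trans (ip_le _ _)) //.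
by rewrite mulrDl mul1r lerD2r -exprMn lerXn2r ?nnegrE // ?mulr_ge0 ?(ltW e0) //.
Qed.

Lemma cp_bounded_le (S : osys R) (phi : {linear S -> bop H}) c c' :
  cp_bounded phi c -> c <= c' -> cp_bounded phi c'.
Proof.
by move=> bc cc' x; rewrite (le_trans (bc x)) // ler_wpM2r // exprn_ge0.
Qed.

Lemma unital_cp_bounded (S : osys R) (phi : {linear S -> bop H}) :
  phi (os_one S) = bop_id H -> cp_bounded phi 1.
Proof. by move=> phi1 x; rewrite phi1 mul1r ip_norm. Qed.

End CpBounds.

(** * Extension of positive functionals *)

Section PositiveExtension.
Local Open Scope classical_set_scope.
Variables (R : realType) (V : lmodType R) (P : V -> Prop).
Hypothesis P_add : forall x y, P x -> P y -> P (x + y).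
Hypothesis P_scale : forall a x, 0 <= a -> P x -> P (a *: x).

(** A partially defined real-linear functional is represented by its graph,
    so that partial functionals are ordered by inclusion.  Single-valuedness is
    not imposed: it follows from positivity as soon as the cone contains 0. *)
Definition positive_linear_graph (G : set (V * R)) :=
  (forall (a : R) p q, G p -> G q -> G (a *: p.1 + q.1, a * p.2 + q.2)) /\
  (forall p, G p -> P p.1 -> 0 <= p.2).

Definition graph_extend (G : set (V * R)) (v : V) (c : R) : set (V * R) :=
  [set p | exists q a, G q /\ p = (q.1 + a *: v, q.2 + a * c)].

(** The domain dominates every vector for the order of the cone, which is what
    makes the bounds in the one-step extension finite. *)
Definition cofinal_graph (G : set (V * R)) :=
  forall v, exists p, G p /\ P (p.1 - v).

(** The new value must lie above the opposites of all [p.2] with [p.1 + v] in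
    the cone and below all [p.2] with [p.1 - v] in the cone; adding two such
    vectors shows that these constraints are compatible, so that the supremum of
    the lower bounds is an admissible value. *)
Lemma graph_extendP (G : set (V * R)) (v : V) :
  positive_linear_graph G -> cofinal_graph G ->
  exists c, positive_linear_graph (graph_extend G v c).
Proof.
move=> [linG posG] cofG.
have subG p q : G p -> G q -> G (p.1 - q.1, p.2 - q.2).
  by move=> Gp Gq; have := linG (-1) _ _ Gq Gp; rewrite scaleN1r mulN1r ![- _ + _]addrC.
have scaleG a p : G p -> G (a *: p.1, a * p.2).
  move=> Gp; have := linG a _ _ Gp (subG _ _ Gp Gp).
  by rewrite /= !subrr !addr0.
pose L := [set - p.2 | p in [set p | G p /\ P (p.1 + v)]].
have L0 : L !=set0.
  have [p [Gp Pp]] := cofG (- v); exists (- p.2); exists p => //.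
  by split=> //; move: Pp; rewrite opprK.
have Lub p : G p -> P (p.1 - v) -> ubound L p.2.
  move=> Gp Pp _ [q [Gq Pq] <-].
  have := posG _ (linG 1 _ _ Gq Gp); rewrite /= scale1r mul1r.
  rewrite -[- _ <= _]subr_ge0 opprK [p.2 + _]addrC; apply.
  by have := P_add Pq Pp; rewrite addrACA subrr addr0.
have supL : has_sup L.
  by split=> //; have [p [Gp Pp]] := cofG v; exists p.2; exact: Lub.
exists (sup L); split.
  move=> a _ _ [p [b [Gp ->]]] [q [d [Gq ->]]] /=.
  exists (a *: p.1 + q.1, a * p.2 + q.2), (a * b + d); split; first exact: linG.
  by rewrite /=; congr (_, _);
    rewrite ?scalerDr ?scalerDl ?scalerA ?mulrDr ?mulrDl ?mulrA addrACA.
move=> _ [p [a [Gp ->]]] /= Pp.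
have [a0|a0|a0] := ltgtP a 0; last 1 first.
- by rewrite a0 mul0r addr0; apply: posG => //; move: Pp; rewrite a0 scale0r addr0.
- have Ga := scaleG (- a)^-1 _ Gp.
  have a0' : 0 < (- a)^-1 by rewrite invr_gt0 oppr_gt0.
  have Pa : P ((- a)^-1 *: p.1 - v).
    have := P_scale (ltW a0') Pp; rewrite scalerDr scalerA.
    by rewrite invrN mulNr mulVf ?scaleN1r // lt_eqF.
  have := ge_sup L0 (Lub _ Ga Pa).
  rewrite /= mulrC ler_pdivlMr ?oppr_gt0 // mulrN lerNl -subr_ge0 opprK.
  by rewrite [sup L * a]mulrC addrC.
have Ga := scaleG a^-1 _ Gp.
have Pa : P (a^-1 *: p.1 + v).
  have := P_scale (ltW (_ : 0 < a^-1)) Pp; rewrite invr_gt0 => /(_ a0).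
  by rewrite scalerDr scalerA mulVf ?scale1r // gt_eqF.
have : - (a^-1 * p.2) <= sup L by apply: sup_upper_bound => //; exists (a^-1 *: p.1, a^-1 * p.2).
rewrite lerNl mulrC ler_pdivlMr // mulNr -subr_ge0 opprK.
by rewrite mulrC.
Qed.

(** The theorem of M. Riesz on extension of positive functionals: a maximal
    positive extension, given by Zorn's lemma, is defined everywhere by the
    one-step extension. *)
Theorem positive_extension (G0 : set (V * R)) :
  positive_linear_graph G0 -> cofinal_graph G0 ->
  exists F : V -> R, [/\ scalar F, forall p, G0 p -> F p.1 = p.2 &
    forall x, P x -> 0 <= F x].
Proof.
move=> goodG0 cofG0.
have [p0 [G0p0 _]] := cofG0 0.
have [|A [goodA maxA]] := @Zorn_bigcup _ [set X | positive_linear_graph (X `|` G0)].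
  move=> F Fgood Ftot.
  (* The union with [G0] also covers the empty chain, for which [set0] stands in
     as the member of the chain. *)
  have mem2 p q : (\bigcup_(X in F) X `|` G0) p -> (\bigcup_(X in F) X `|` G0) q ->
     exists2 X, (X = set0 \/ F X) & (X `|` G0) p /\ (X `|` G0) q.
    move=> [[X FX Xp]|G0p] [[Y FY Yq]|G0q].
    - have [XY|YX] := Ftot _ _ FX FY.
        by exists Y; [right|split; left=> //; exact: XY].
      by exists X; [right|split; left=> //; exact: YX].
    - by exists X; [right|split; [left|right]].
    - by exists Y; [right|split; [right|left]].
    - by exists set0; [left|split; right].
  have good0 X : (X = set0 \/ F X) -> positive_linear_graph (X `|` G0).
    by case=> [->|/Fgood//]; rewrite set0U.
  have sub X : (X = set0 \/ F X) -> (X `|` G0) `<=` (\bigcup_(X in F) X `|` G0).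
    by case=> [->|FX] p [//|]; [right|left; exists X|right].
  split.
    move=> a p q Fp Fq; have [X FX [Xp Xq]] := mem2 _ _ Fp Fq.
    by apply: (sub X) => //; apply: (good0 X FX).1.
  move=> p Fp; have [X FX [Xp _]] := mem2 _ _ Fp Fp.
  exact: (good0 X FX).2.
pose G := A `|` G0.
have subG p q : G p -> G q -> G (p.1 - q.1, p.2 - q.2).
  move=> Gp Gq; have := goodA.1 (-1) _ _ Gq Gp.
  by rewrite scaleN1r mulN1r ![- _ + _]addrC.
have G00 : G (0, 0).
  by have := subG p0 p0 (or_intror G0p0) (or_intror G0p0); rewrite !subrr.
have total v : exists r, G (v, r).
  have cofG : cofinal_graph G.
    by move=> w; have [p [G0p Pp]] := cofG0 w; exists p; split=> //; right.
  have [c goodc] := graph_extendP v goodA cofG.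
  have subGc : G `<=` graph_extend G v c.
    by move=> p Gp; exists p, 0; rewrite scale0r mul0r !addr0 -surjective_pairing.
  exists c; apply: contrapT => nGv; apply: (maxA (graph_extend G v c)).
    split; first by move=> p Ap; apply: subGc; left.
    move=> /(_ (v, c)) h; apply: nGv; left; apply: h.
    by exists (0, 0), 1; rewrite scale1r mul1r !add0r.
  rewrite /= (_ : graph_extend G v c `|` G0 = graph_extend G v c) //.
  by apply/setUidPl => p G0p; apply: subGc; right.
have P0 : P 0 by have [p [_ Pp]] := cofG0 0; rewrite -(scale0r (p.1 - 0)); exact: P_scale.
have uniqG v r s : G (v, r) -> G (v, s) -> r = s.
  have le r' s' : G (v, r') -> G (v, s') -> s' <= r'.
    move=> Gr Gs; rewrite -subr_ge0.
    by apply: (goodA.2 _ (subG _ _ Gr Gs)); rewrite /= subrr.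
  by move=> Gr Gs; apply/eqP; rewrite eq_le !le.
have [F GF] := choice total.
exists F; split=> [a x y|[v r] G0v|x Px].
- exact: uniqG (GF _) (goodA.1 a _ _ (GF x) (GF y)).
- by apply: uniqG (GF _) _; right.
- exact: (goodA.2 _ (GF x)).
Qed.

End PositiveExtension.

Lemma scalar_morphisms (K : nzRingType) (V : lmodType K) (G : V -> K) :
  scalar G -> [/\ {morph G : x y / x + y}, G 0 = 0,
    forall c x, G (c *: x) = c * G x & {morph G : x / - x}].
Proof.
move=> linG.
have GD x y : G (x + y) = G x + G y by rewrite -[x in LHS]scale1r linG mul1r.
have G0 : G 0 = 0 by apply: (addrI (G 0)); rewrite -GD !addr0.
have GZ c x : G (c *: x) = c * G x by rewrite -[c *: x]addr0 linG G0 addr0.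
by split=> // x; rewrite -scaleN1r GZ mulN1r.
Qed.

(** A complex vector space seen as a real one; the separate name carries the
    second module structure. *)
Definition realified (R : realType) (V : lmodType R[i]) : Type := V.

Section Realified.
Variables (R : realType) (V : lmodType R[i]).
Local Notation VR := (realified V).
HB.instance Definition _ := GRing.Zmodule.on VR.

Definition realified_scale (a : R) (v : VR) : VR := (a%:C%C : R[i]) *: (v : V).

Lemma realified_scaleA a b v :
  realified_scale a (realified_scale b v) = realified_scale (a * b) v.
Proof. by rewrite /realified_scale scalerA -rmorphM. Qed.
Lemma realified_scale1 : left_id 1 realified_scale.
Proof. by move=> v; rewrite /realified_scale scale1r. Qed.
Lemma realified_scaleDr : right_distributive realified_scale +%R.
Proof. by move=> a v w; rewrite /realified_scale -scalerDr. Qed.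
Lemma realified_scaleDl v : {morph realified_scale^~ v : a b / a + b}.
Proof. by move=> a b; rewrite /realified_scale rmorphD scalerDl. Qed.

HB.instance Definition _ := GRing.Zmodule_isLmodule.Build R VR
  realified_scaleA realified_scale1 realified_scaleDr realified_scaleDl.

(** The complex-linear functional whose real part is a given real-linear one. *)
Definition complexify (F : VR -> R) (v : V) : R[i] :=
  (F v -i* F ('i%C *: v))%C.

Lemma complexify_scalar (F : VR -> R) : scalar F -> scalar (complexify F).
Proof.
move=> linF [a b] v w.
have [FD F0 FZ' _] := scalar_morphisms linF.
have FZ c x : F (c%:C%C *: (x : V)) = c * F x by exact: FZ'.
have Z (x : V) : (a +i* b)%C *: x = a%:C%C *: x + b%:C%C *: ('i%C *: x).
  by rewrite scalerA -scalerDl; congr (_ *: _); simpc.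
have iZ (x : V) : 'i%C *: ((a +i* b)%C *: x) = a%:C%C *: ('i%C *: x) + (- b)%:C%C *: x.
  by rewrite !scalerA -scalerDl; congr (_ *: _); simpc.
rewrite /complexify scalerDr iZ Z !FD !FZ.
by apply/eqP; rewrite eq_complex /=; apply/andP; split; apply/eqP; ring.
Qed.

End Realified.

(** * Extension of matrix-valued completely positive maps *)

Section OsVal.
Variables (R : realType) (S : osys R).

(** The projection [os_val] under a name that carries a linear structure. *)
Definition os_incl (s : S) : bop (os_hilb S) := os_val s.
Lemma os_incl_linear : linear os_incl. Proof. by []. Qed.
HB.instance Definition _ := GRing.isLinear.Build _ _ _ _ os_incl os_incl_linear.
End OsVal.

Section MatrixExtension.
Local Open Scope classical_set_scope.
Variables (R : realType) (S' S : osys R) (lam : {linear S' -> S}).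
Hypothesis lam_coe : unital_coe lam.
Variables (k : nat) (phi : {linear S' -> 'M[R[i]]_k}).
Hypothesis phi_ucp : ucp_mat phi.
Local Notation H := (os_hilb S).
Local Notation V := ('I_k -> 'I_k -> S).

Definition os_form (A : V) (x : 'I_k -> H) : R[i] :=
  bop_form (fun i j => os_val (A i j)) x.

Lemma os_formD A B x : os_form (A + B) x = os_form A x + os_form B x.
Proof. exact: bop_formD. Qed.
Lemma os_formZ c A x : os_form (c *: A) x = c * os_form A x.
Proof. exact: bop_formZ. Qed.

(** The cone used for the extension consists of the elements with positive
    real part.  Unlike the cone of positive elements it contains all
    skew-adjoint elements and their opposites, so that a real functional that
    is nonnegative on it vanishes there and has a hermitian complexification. *)
Definition accretive (A : realified V) : Prop :=
  forall x, 0 <= complex.Re (os_form A x).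

(** Up to normalization, the value of the amplified map on [B] at the maximally
    entangled vector.  This correspondence between linear maps into [k]-by-[k]
    matrices and functionals on [k]-by-[k] matrices over the domain exchanges
    complete positivity and positivity. *)
Definition choi_functional (B : 'I_k -> 'I_k -> S') : R[i] := \sum_i \sum_j phi (B i j) i j.

Lemma choi_functionalD B C : choi_functional (B + C) = choi_functional B + choi_functional C.
Proof.
rewrite /choi_functional -big_split; apply: eq_bigr => i _.
by rewrite -big_split; apply: eq_bigr => j _; rewrite linearD mxE.
Qed.

Lemma choi_functionalZ c B : choi_functional (c *: B) = c * choi_functional B.
Proof.
rewrite /choi_functional mulr_sumr; apply: eq_bigr => i _.
by rewrite mulr_sumr; apply: eq_bigr => j _; rewrite linearZ mxE.
Qed.

Definition lam_mx (B : 'I_k -> 'I_k -> S') : V := fun i j => lam (B i j).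

Lemma lam_mxD B C : lam_mx (B + C) = lam_mx B + lam_mx C.
Proof. by apply/funext => i; apply/funext => j; exact: linearD. Qed.
Lemma lam_mxZ c B : lam_mx (c *: B) = c *: lam_mx B.
Proof. by apply/funext => i; apply/funext => j; exact: linearZ_LR. Qed.

(** If [B] has positive real part, then [B] plus its adjoint is positive over
    [S]; the embedding reflects positivity, so this already holds over [S'],
    where [phi] can be applied. *)
Lemma choi_functional_pos B : accretive (lam_mx B) -> 0 <= complex.Re (choi_functional B).
Proof.
move=> posB.
have adjB ij : exists s : S', adjoint_of (B ij.2 ij.1) s by exact: osys_adjoint.
have [B' BB'] := choice adjB.
have cp_lam : cp_bop (@os_incl R S \o lam : {linear S' -> bop H}).
  move=> n A /lam_coe.2.2 posA x; have := posA x.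
  by congr (0 <= _); apply: eq_bigr => i _; apply: eq_bigr => j _; rewrite !mxE.
have formB' x : os_form (lam_mx (fun i j => B' (i, j))) x = (os_form (lam_mx B) x)^*.
  by apply: bop_form_adjoint => i j y z; exact: (cp_adjoint cp_lam y z (BB' (i, j))).
have posM : os_mx_pos (\matrix_(i, j) (B i j + B' (i, j))).
  apply/lam_coe.2.2 => x.
  rewrite (_ : \sum_i _ = os_form (lam_mx (B + (fun i j => B' (i, j)))) x).
    rewrite lam_mxD os_formD formB' -[X in _ + X^*]/(_) addcJ.
    by rewrite mulr_ge0 ?ler0n // ler0c.
  by apply: eq_bigr => i _; apply: eq_bigr => j _; rewrite !mxE.
have := phi_ucp.2 _ _ posM (fun i => delta_mx i 0).
have -> : (\sum_i \sum_j (map_mx Num.conj (delta_mx i 0 : 'cV[R[i]]_k))^T *m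
     map_mx phi (\matrix_(i, j) (B i j + B' (i, j))) i j *m
      (delta_mx j 0 : 'cV[R[i]]_k)) 0 0 = choi_functional (B + (fun i j => B' (i, j))).
  rewrite summxE; apply: eq_bigr => i _; rewrite summxE; apply: eq_bigr => j _.
  by rewrite map_delta_mx trmx_delta -rowE -colE !mxE.
(* Matrices with one column are column vectors, so [hs_left] with one column is
   the action of [phi] on vectors. *)
have phi_adj (s s' : S') i j : adjoint_of s s' -> phi s' i j = (phi s j i)^*.
  move=> ss'.
  have := cp_adjoint (@hs_left_cp R k 1 _ _ phi_ucp) (delta_mx j 0) (delta_mx i 0) ss'.
  have ipE (C : 'M[R[i]]_k) a b :
      ip (hs_hilbert R k 1) (C *m delta_mx a 0) (delta_mx b 0) = C b a.
    rewrite hs_ipH (bigD1 b) //= [X in _ + X]big1 ?addr0.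
      by rewrite big_ord1 -colE !mxE !eqxx conjC1 mulr1.
    by move=> c cb; rewrite big_ord1 !mxE (negbTE cb) /= conjC0 mulr0.
  by rewrite /= !ipE.
have -> : choi_functional (B + (fun i j => B' (i, j))) = choi_functional B + (choi_functional B)^*.
  rewrite choi_functionalD; congr (_ + _).
  rewrite /choi_functional rmorph_sum /= exchange_big; apply: eq_bigr => i _.
  rewrite rmorph_sum; apply: eq_bigr => j _ /=.
  exact: phi_adj (BB' (j, i)).
move=> /complex_Re_ge0; rewrite complex_ReD complex_Re_conj -mulr2n.
by rewrite pmulrn_lge0.
Qed.

Definition lam_graph : set (realified V * R) :=
  [set p | exists B, p = (lam_mx B, complex.Re (choi_functional B))].

Lemma lam_graph_linear : positive_linear_graph accretive lam_graph.
Proof.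
split=> [a _ _ [B ->] [C ->] /=|_ [B ->]]; last exact: choi_functional_pos.
exists ((a%:C%C : R[i]) *: B + C).
by rewrite lam_mxD lam_mxZ choi_functionalD choi_functionalZ complex_ReD complex_Re_real.
Qed.

(** The unit of [S'] is sent to that of [S], where a multiple of it dominates
    any given bounded element. *)
Lemma lam_graph_cofinal : cofinal_graph accretive lam_graph.
Proof.
move=> A.
have [c c0 bA] := bop_form_bounded (fun i j => os_val ((A : V) i j)).
pose B (i j : 'I_k) : S' := if i == j then c *: os_one S' else 0.
exists (lam_mx B, complex.Re (choi_functional B)); split; first by exists B.
move=> x /=; rewrite -[lam_mx B - A]/((lam_mx B : V) - (A : V)).
rewrite -scaleN1r os_formD os_formZ mulN1r complex_ReD raddfN subr_ge0.
apply: complex_Re_le; apply: le_trans (bA x) _.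
rewrite mulr_sumr /os_form /bop_form le_eqVlt; apply/orP; left; apply/eqP.
apply: eq_bigr => i _; rewrite (bigD1 i) //= big1 ?addr0.
  rewrite /lam_mx /B eqxx linearZ_LR lam_coe.1.
  by rewrite -ip_norm -ipZl.
by move=> j ji; rewrite /lam_mx /B eq_sym (negbTE ji) linear0; exact: ip0l.
Qed.

(** The matrix case of Arveson's extension theorem, which for matrix targets
    goes back to Krein: the functional of [phi] is extended and read back as a
    map, entry by entry on the elementary matrices. *)
Theorem ucp_mat_extension : exists phi' : {linear S -> 'M[R[i]]_k},
  ucp_mat phi' /\ phi' \o lam =1 phi.
Proof.
have [||F [linF Flam Fpos]] :=
    positive_extension _ _ lam_graph_linear lam_graph_cofinal.
- by move=> A B pA pB x; rewrite os_formD complex_ReD addr_ge0.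
- by move=> a A a0 pA x; rewrite os_formZ complex_Re_real mulr_ge0.
pose G := complexify F; have linG := complexify_scalar linF.
pose E i j (s : S) : V := fun a b => if (a == i) && (b == j) then s else 0.
pose phi' s : 'M[R[i]]_k := \matrix_(i, j) G (E i j s).
have lin_phi' : linear phi'.
  move=> a s t; apply/matrixP => i j; rewrite !mxE -linG; congr (G _).
  apply/funext => b; apply/funext => c; rewrite !fctE /E.
  by case: ifP => _; rewrite ?scaler0 ?addr0.
pose Phi : {linear S -> 'M[R[i]]_k} :=
  HB.pack phi' (GRing.isLinear.Build _ _ _ _ phi' lin_phi').
have G_lam B : G (lam_mx B) = choi_functional B.
  have FB C : F (lam_mx C) = complex.Re (choi_functional C).
    by apply: (Flam (lam_mx C, _)); exists C.
  rewrite /G /complexify -lam_mxZ !FB choi_functionalZ.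
  case: (choi_functional B) => a b /=.
  by apply/eqP; rewrite eq_complex /= !mul0r mul1r sub0r opprK !eqxx.
have Phi_lam : Phi \o lam =1 phi.
  move=> s; apply/matrixP => i j; rewrite /= mxE.
  pose B a b := if (a == i) && (b == j) then s else 0.
  have -> : E i j (lam s) = lam_mx B.
    apply/funext => a; apply/funext => b; rewrite /E /lam_mx /B.
    by case: ifP; rewrite ?linear0.
  rewrite G_lam /choi_functional (bigD1 i) //= (bigD1 j) //= /B !eqxx /= !big1 ?addr0 //.
    move=> a ai; rewrite big1 // => b _; rewrite (negbTE ai) /=.
    by rewrite linear0 mxE.
  by move=> b bj; rewrite (negbTE bj) /= linear0 mxE.
exists Phi; split=> //; split.
  rewrite -(lam_coe.1); rewrite -[LHS]/((Phi \o lam) _) Phi_lam.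
  exact: phi_ucp.1.
move=> n A posA x.
have [GD G0 GZ _] := scalar_morphisms linG.
have [_ _ _ FN] := scalar_morphisms linF.
have GZV c (B : V) : G (c *: B) = c * G B by exact: GZ.
have Gsum n' (f : 'I_n' -> V) : G (\sum_i f i) = \sum_i G (f i).
  exact: (big_morph G GD G0).
(* Compressing the positive matrix [A] by the scalar matrix with rows [x p]
   gives a positive [k]-by-[k] matrix [Y] over [S], at which the functional
   takes the value of the form to be estimated. *)
pose Y : V := \sum_p \sum_q \sum_a \sum_c (x q c 0 * (x p a 0)^*) *: E a c (A p q).
have form_E a c s z : os_form (E a c s) z = ip H (s (z c)) (z a).
  rewrite /os_form /bop_form (bigD1 a) //= (bigD1 c) //= /E !eqxx /= !big1 ?addr0 //.
    by move=> b ba; rewrite big1 // => d _; rewrite (negbTE ba); exact: ip0l.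
  by move=> d dc; rewrite (negbTE dc); exact: ip0l.
have form_Y z : 0 <= os_form Y z.
  have form0 : os_form 0 z = 0 by rewrite -(scale0r 0) os_formZ mul0r.
  have formD B C : os_form (B + C) z = os_form B z + os_form C z by exact: os_formD.
  pose w p : H := \sum_a x p a 0 *: z a.
  have := posA w; congr (0 <= _); symmetry.
  rewrite /Y (big_morph _ formD form0); apply: eq_bigr => p _.
  rewrite (big_morph _ formD form0); apply: eq_bigr => q _.
  rewrite mxE (big_morph _ formD form0) [w p]/w.
  rewrite (big_morph _ (ipDr _) (linear0r _ _)); apply: eq_bigr => a _.
  rewrite ipZr (big_morph _ formD form0).
  rewrite (big_morph _ (bopD _) (bop0 _)).
  rewrite (big_morph _ (fun x y => ipDl x y _) (ip0l _)) mulr_sumr.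
  apply: eq_bigr => c _.
  by rewrite os_formZ form_E bopZ ipZl mulrCA mulrA.
have -> : (\sum_p \sum_q (map_mx Num.conj (x p))^T *m map_mx Phi A p q *m x q) 0 0 = G Y.
  rewrite /Y Gsum summxE; apply: eq_bigr => p _.
  rewrite Gsum summxE; apply: eq_bigr => q _.
  rewrite Gsum mat_formE; apply: eq_bigr => a _.
  rewrite Gsum; apply: eq_bigr => c _.
  by rewrite GZV !mxE -mulrA mulrC.
(* [i Y] is skew-adjoint, hence accretive together with its opposite. *)
have Fi : F ('i%C *: Y) = 0.
  have re0 z : complex.Re ('i%C * os_form Y z) = 0.
    by have /ger0_Im := form_Y z; case: (os_form Y z) => a b /= ->; rewrite mul0r mulr0 subr0.
  apply/eqP; rewrite eq_le; apply/andP; split.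
    rewrite -oppr_ge0 -[- F _]FN; apply: Fpos => z.
    by rewrite -[X in os_form X]/(- ('i%C *: Y)) -scaleNr os_formZ mulNr raddfN /= re0 oppr0.
  by apply: Fpos => z; rewrite os_formZ re0.
rewrite /G /complexify Fi oppr0 ler0c; apply: Fpos => z.
exact: complex_Re_ge0.
Qed.

End MatrixExtension.

(** * Adjoints and approximation in the tensor product *)

(** The adjoint of [s (x) t] is [s* (x) t*].  Describing it by its
    effect under product maps lets the choice of [s*] and [t*] go summand by
    summand; commutation of the two maps restores the order of the factors. *)
Lemma tensor_adjoint (R : realType) (S T : osys R) (w : tensor S T) :
  exists w' : tensor S T,
  forall (H : hilbert R) (phi : {linear S -> bop H}) (psi : {linear T -> bop H}),
    cp_bop phi -> cp_bop psi -> commuting phi psi ->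
    forall x y, ip H (product_map phi psi w' x) y =
                (ip H (product_map phi psi w y) x)^*.
Proof.
elim/tensor_ind: w => [|w1 w2 [w1' h1] [w2' h2]|s t].
- by exists 0 => *; rewrite !linear0 !ip0l conjC0.
- exists (w1' + w2') => H phi psi cphi cpsi com x y.
  by rewrite !linearD !bop_addE !ipDl rmorphD /= h1 // h2.
have [s' ss'] := osys_adjoint s; have [t' tt'] := osys_adjoint t.
exists (tens s' t') => H phi psi cphi cpsi com x y.
rewrite !product_map_tens com /= (cp_adjoint cpsi _ _ tt').
by rewrite [ip _ (psi t y) _]ipC (cp_adjoint cphi _ _ ss') conjCK.
Qed.

Section Approximation.
Variables (R : realType) (S_ : nat -> osys R) (S T : osys R).
Variables (u : forall n, {linear S_ n -> S_ n.+1}) (lam : forall n, {linear S_ n -> S}).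
Hypothesis lam_u : forall n x, lam n x = lam n.+1 (u n x).
Hypothesis lam_dense : forall (s : S) (e : R[i]), 0 < e ->
  exists n (x : S_ n), op_norm_le (s - lam n x) e.

Lemma lam_shift n N (x : S_ n) : (n <= N)%N -> exists y : S_ N, lam N y = lam n x.
Proof.
move/subnKC <-; elim: (N - n)%N => [|d [y yx]]; first by rewrite addn0; exists x.
by rewrite addnS; exists (u _ y); rewrite -lam_u.
Qed.

(** The approximating stage can be taken arbitrarily late, which is needed to
    treat finitely many elements at one common stage. *)
Lemma lam_dense_cofinal (s : S) (e : R[i]) : 0 < e ->
  exists N0, forall N, (N0 <= N)%N -> exists x : S_ N, op_norm_le (s - lam N x) e.
Proof.
move=> /(lam_dense s) [N0 [x sx]]; exists N0 => N /(lam_shift x)[y yx].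
by exists y; rewrite yx.
Qed.

(** Only the first legs of the elementary tensors are moved.  The error of one
    of them is bounded by the norm of the moved leg times a factor depending on
    the fixed second leg, and otherwise only on a bound [c] for the two maps at
    the unit; in particular one approximant serves all pairs of unital maps. *)
Lemma tensor_approx (x : tensor S T) (d : R[i]) : 0 < d ->
  exists N0, forall N, (N0 <= N)%N -> exists w : tensor (S_ N) T,
  forall (H : hilbert R) (phi : {linear S -> bop H}) (psi : {linear T -> bop H}) c,
    cp_bop phi -> cp_bop psi -> 0 < c -> cp_bounded phi c -> cp_bounded psi c ->
    forall a b : H,
    `|ip H (product_map phi psi x a) b -
      ip H (product_map (phi \o lam N : {linear S_ N -> bop H}) psi w a) b|
    <= d * (c * (1 + c ^+ 2)) * (`|a| ^+ 2 + `|b| ^+ 2).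
Proof.
elim/tensor_ind: x d => [|x y IHx IHy|s t] d d0.
- exists 0 => N _; exists 0 => H phi psi c _ _ c0 _ _ a b.
  rewrite !linear0 ip0l subrr normr0.
  have [/ltW d0' /ltW c0'] := (d0, c0).
  by rewrite ?(mulr_ge0, addr_ge0, exprn_ge0).
- have d2 : 0 < d / 2 by rewrite divr_gt0.
  have [Nx hx] := IHx _ d2; have [Ny hy] := IHy _ d2.
  exists (maxn Nx Ny) => N; rewrite geq_max => /andP[/hx[wx {}hx] /hy[wy {}hy]].
  exists (wx + wy) => H phi psi c cphi cpsi c0 phic psic a b.
  rewrite !linearD !bop_addE !ipDl opprD addrACA (le_trans (ler_normD _ _)) //.
  rewrite [X in _ <= X * _ * _](splitr d) !mulrDl.
  by rewrite lerD ?hx ?hy.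
have [tau tau0 ttau] := bop_bounded t.
(* Chosen so that the bound [e c (|b|^2 + 4 tau^2 c^2 |a|^2)] obtained below is
   at most the required one. *)
pose e := d / (1 + 4 * tau ^+ 2).
have D0 : 0 < 1 + 4 * tau ^+ 2 by rewrite ltr_pwDl // mulr_ge0 // exprn_ge0 // ltW.
have e0 : 0 < e by rewrite divr_gt0.
have [N0 h] := lam_dense_cofinal s e0.
exists N0 => N /h[z sz]; exists (tens z t) => H phi psi c cphi cpsi c0 phic psic a b.
rewrite product_map_restrict !product_map_tens /=.
have -> : ip H (phi s (psi t a)) b - ip H (phi (lam N z) (psi t a)) b =
          ip H (phi (s - lam N z) (psi t a)) b.
  by rewrite linearB bop_addE ipDl bop_oppE ipNl.
apply: (le_trans (cp_form_le cphi phic b (psi t a) e0 sz)).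
have := cp_norm_le cpsi c0 psic a tau0 ttau.
rewrite exprMn; set W := `|psi t a| ^+ 2; set A := `|a| ^+ 2; set B := `|b| ^+ 2 => h2.
apply: (@le_trans _ _ (e * c * (B + 4 * (tau ^+ 2 * c ^+ 2) * A))).
  by rewrite (ler_pM2l (mulr_gt0 e0 c0)) lerD2l.
have -> : d = e * (1 + 4 * tau ^+ 2) by rewrite divfK ?lt0r_neq0.
rewrite -subr_ge0.
set t2 := tau ^+ 2; set c2 := c ^+ 2.
have t20 : 0 <= t2 by rewrite exprn_ge0 ?ltW.
have c20 : 0 <= c2 by rewrite exprn_ge0 ?ltW.
have A0 : 0 <= A by rewrite exprn_ge0.
have B0 : 0 <= B by rewrite exprn_ge0.
rewrite (_ : _ - _ = e * c * ((1 + c2 + 4 * t2) * A + (c2 + 4 * t2 + 4 * t2 * c2) * B)).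
  have [/ltW e0' /ltW c0'] := (e0, c0).
  clearbody e t2 c2; by rewrite ?(mulr_ge0, addr_ge0).
by ring.
Qed.

End Approximation.

(** * The two families of cones *)

Section TensorForms.
Variable R : realType.

Definition product_form (S T : osys R) (H : hilbert R) (phi : {linear S -> bop H})
    (psi : {linear T -> bop H}) n (u : 'M[tensor S T]_n) (x : 'I_n -> H) : R[i] :=
  bop_form (fun i j => product_map phi psi (u i j)) x.

Lemma c_tensorP (S T : osys R) n (u : 'M[tensor S T]_n) : c_tensor u <->
  forall (H : hilbert R) (phi : {linear S -> bop H}) (psi : {linear T -> bop H}),
    cp_bop phi -> cp_bop psi -> commuting phi psi ->
    forall x, 0 <= product_form phi psi u x.
Proof.
have formE (H : hilbert R) (phi : {linear S -> bop H}) (psi : {linear T -> bop H}) x :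
    \sum_i \sum_j ip H ((map_mx (product_map phi psi) u) i j (x j)) (x i) =
    product_form phi psi u x.
  by apply: eq_bigr => i _; apply: eq_bigr => j _; rewrite mxE.
split=> cu H phi psi cphi cpsi com x; first by rewrite -formE; exact: cu.
by rewrite formE; exact: cu.
Qed.

(** This puts the two cones in the same form: the min cone is tested by some of
    the commuting pairs that test the c cone. *)
Lemma min_tensorP (S T : osys R) n (u : 'M[tensor S T]_n) : min_tensor u <->
  forall k m (phi : {linear S -> 'M[R[i]]_k}) (psi : {linear T -> 'M[R[i]]_m}),
    ucp_mat phi -> ucp_mat psi ->
    forall x, 0 <= product_form (hs_left m phi) (hs_right k psi) u x.
Proof.
have formE k m (phi : {linear S -> 'M[R[i]]_k}) (psi : {linear T -> 'M[R[i]]_m}) x :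
    product_form (hs_left m phi) (hs_right k psi) u x =
    (\sum_i \sum_j (map_mx Num.conj (hs_vec (x i)))^T *m
       map_mx (tensor_map phi psi) u i j *m hs_vec (x j)) 0 0.
  rewrite summxE; apply: eq_bigr => i _; rewrite summxE; apply: eq_bigr => j _.
  by rewrite hs_product_form !mxE.
split=> mu k m phi psi uphi upsi x; first by rewrite formE; exact: mu.
have := mu k m phi psi uphi upsi (fun i => hs_unvec (x i)).
rewrite formE; congr (0 <= _); congr (fun_of_matrix _ 0 0).
by apply: eq_bigr => i _; apply: eq_bigr => j _; rewrite !hs_unvecK.
Qed.

Lemma c_tensor_min (S T : osys R) n (u : 'M[tensor S T]_n) :
  c_tensor u -> min_tensor u.
Proof.
move=> /c_tensorP cu; apply/min_tensorP => k m phi psi uphi upsi x.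
by apply: cu; [exact: hs_left_cp|exact: hs_right_cp|exact: hs_commuting].
Qed.

End TensorForms.

Section Symmetrization.
Variables (R : realType) (S T : osys R) (n : nat).
Implicit Types w : 'M[tensor S T]_n.

Definition adjoint_tensors w (w' : 'M[tensor S T]_n) :=
  forall (H : hilbert R) (phi : {linear S -> bop H}) (psi : {linear T -> bop H}),
    cp_bop phi -> cp_bop psi -> commuting phi psi ->
    forall i j x y, ip H (product_map phi psi (w' i j) x) y =
                    (ip H (product_map phi psi (w j i) y) x)^*.

Lemma adjoint_tensors_exists w : exists w', adjoint_tensors w w'.
Proof.
have [f hf] := choice (fun ij : 'I_n * 'I_n => tensor_adjoint (w ij.2 ij.1)).
exists (\matrix_(i, j) f (i, j)) => H phi psi cphi cpsi com i j x y.
by rewrite mxE; exact: hf.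
Qed.

Lemma product_form_adjoint w (w' : 'M[tensor S T]_n) (H : hilbert R) (phi : {linear S -> bop H})
    (psi : {linear T -> bop H}) (x : 'I_n -> H) :
  adjoint_tensors w w' -> cp_bop phi -> cp_bop psi -> commuting phi psi ->
  product_form phi psi w' x = (product_form phi psi w x)^*.
Proof.
by move=> ww' cphi cpsi com; apply: bop_form_adjoint => i j a b; exact: ww'.
Qed.

Lemma product_formD (H : hilbert R) (phi : {linear S -> bop H})
    (psi : {linear T -> bop H}) w (w' : 'M[tensor S T]_n) (x : 'I_n -> H) :
  product_form phi psi (w + w') x = product_form phi psi w x + product_form phi psi w' x.
Proof.
rewrite /product_form -bop_formD; congr (bop_form _ x).
by apply/funext => i; apply/funext => j; rewrite mxE linearD.
Qed.

Definition tensor_mxZ (c : R[i]) w : 'M[tensor S T]_n := \matrix_(i, j) (c *: w i j).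

Lemma product_formZ (H : hilbert R) (phi : {linear S -> bop H})
    (psi : {linear T -> bop H}) c w (x : 'I_n -> H) :
  product_form phi psi (tensor_mxZ c w) x = c * product_form phi psi w x.
Proof.
rewrite /product_form -bop_formZ; congr (bop_form _ x).
by apply/funext => i; apply/funext => j; rewrite mxE linearZ_LR.
Qed.

Definition tensor_mx1 : 'M[tensor S T]_n :=
  \matrix_(i, j) (if i == j then tens (os_one S) (os_one T) else 0).

Lemma product_form1 (H : hilbert R) (phi : {linear S -> bop H})
    (psi : {linear T -> bop H}) (x : 'I_n -> H) :
  product_form phi psi tensor_mx1 x =
  \sum_i ip H (phi (os_one S) (psi (os_one T) (x i))) (x i).
Proof.
apply: eq_bigr => i _; rewrite (bigD1 i) //= big1 ?addr0.
  by rewrite mxE eqxx product_map_tens.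
by move=> j ji; rewrite mxE eq_sym (negbTE ji) linear0; exact: ip0l.
Qed.

Lemma eq_product_form (H : hilbert R) (phi phi' : {linear S -> bop H})
    (psi : {linear T -> bop H}) w (x : 'I_n -> H) :
  phi =1 phi' -> product_form phi psi w x = product_form phi' psi w x.
Proof.
move=> eq_phi; apply: eq_bigr => i _; apply: eq_bigr => j _.
by rewrite (eq_product_map _ _ eq_phi).
Qed.

End Symmetrization.

(** * Inductive limits *)

Section InductiveLimit.
Variables (R : realType) (S_ : nat -> osys R).
Variables (u : forall n, {linear S_ n -> S_ n.+1}).
Variables (S : osys R) (lam : forall n, {linear S_ n -> S}) (T : osys R).
Hypothesis lam_coe : forall n, unital_coe (lam n).
Hypothesis lam_u : forall n x, lam n x = lam n.+1 (u n x).
Hypothesis lam_dense : forall (s : S) (e : R[i]), 0 < e ->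
  exists n (x : S_ n), op_norm_le (s - lam n x) e.
Hypothesis S_nuc : forall N n (w : 'M[tensor (S_ N) T]_n), min_tensor w -> c_tensor w.

(** A common stage for all entries of the matrix. *)
Lemma product_form_approx n (w : 'M[tensor S T]_n) (d : R[i]) : 0 < d ->
  exists N (v : 'M[tensor (S_ N) T]_n),
  forall (H : hilbert R) (phi : {linear S -> bop H}) (psi : {linear T -> bop H}) c,
    cp_bop phi -> cp_bop psi -> 0 < c -> cp_bounded phi c -> cp_bounded psi c ->
    forall x : 'I_n -> H,
    `|product_form phi psi w x -
      product_form (phi \o lam N : {linear S_ N -> bop H}) psi v x|
    <= d * (c * (1 + c ^+ 2)) * (2 * n%:R * \sum_i `|x i| ^+ 2).
Proof.
move=> d0.
have [N0 hN0] := choice (fun ij : 'I_n * 'I_n =>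
  tensor_approx lam_u lam_dense (w ij.1 ij.2) d0).
pose N := \max_ij N0 ij.
have [v hv] := choice (fun ij => hN0 ij N (leq_bigmax ij)).
exists N, (\matrix_(i, j) v (i, j)) => H phi psi c cphi cpsi c0 phic psic x.
apply: bop_form_close => i j a b; rewrite mxE.
exact: (hv (i, j)).
Qed.

(** The perturbed symmetrized approximant is min-positive because its matrix
    tests extend to tests of [w]; nuclearity transports this to the given pair,
    and all error terms are proportional to [d]. *)
Lemma min_tensor_real_part n (w : 'M[tensor S T]_n) : min_tensor w ->
  forall (H : hilbert R) (phi : {linear S -> bop H}) (psi : {linear T -> bop H}),
    cp_bop phi -> cp_bop psi -> commuting phi psi ->
    forall x, 0 <= product_form phi psi w x + (product_form phi psi w x)^*.
Proof.
move=> /min_tensorP minw H phi psi cphi cpsi com x.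
have [c1 c10 phic1] := cp_bounded_exists cphi.
have [c2 c20 psic2] := cp_bounded_exists cpsi.
pose c := c1 + c2; have c0 : 0 < c by rewrite addr_gt0.
have phic : cp_bounded phi c by apply: cp_bounded_le phic1 _; rewrite lerDl ltW.
have psic : cp_bounded psi c by apply: cp_bounded_le psic2 _; rewrite lerDr ltW.
pose C := c * (1 + c ^+ 2) * (2 * n%:R * \sum_i `|x i| ^+ 2).
pose one := product_form phi psi (tensor_mx1 S T n) x.
apply: (@real_ge0_of_perturbation _ _ (2 * C + 8 * n%:R * one));
  first exact: add_conj_real.
move=> d d0; have [N [v approx]] := product_form_approx w d0.
have [v' vv'] := adjoint_tensors_exists v.
(* For unital maps the approximation error is at most [4 n d] times the squared
   norm of the vector; passing to twice the real part doubles it. *)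
pose d' : R[i] := 8 * n%:R * d.
have cp_lam : completely_positive (@os_mx_pos R (S_ N)) (@os_mx_pos R S) (lam N).
  by move=> m A posA; apply/(lam_coe N).2.2.
have min_v : min_tensor (v + v' + tensor_mxZ d' (tensor_mx1 (S_ N) T n)).
  apply/min_tensorP => k m f g uf ug y.
  have [F [uF Ff]] := ucp_mat_extension (lam_coe N) uf.
  rewrite !product_formD product_formZ product_form1.
  have -> : \sum_i ip (hs_hilbert R k m) (hs_left m f (os_one (S_ N))
      (hs_right k g (os_one T) (y i))) (y i) = \sum_i `|y i| ^+ 2.
    by apply: eq_bigr => i _; rewrite hs_left1 // hs_right1 // -ip_norm.
  rewrite (product_form_adjoint _ vv'); [|exact: hs_left_cp|exact: hs_right_cp|exact: hs_commuting].
  have -> : product_form (hs_left m f) (hs_right k g) v y =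
      product_form (hs_left m F \o lam N : {linear S_ N -> _}) (hs_right k g) v y.
    by apply: eq_product_form => s; rewrite /= -[f s]Ff.
  have := approx _ (hs_left m F) (hs_right k g) 1 (hs_left_cp uF) (hs_right_cp ug)
    ltr01 (unital_cp_bounded (hs_left1 m uF)) (unital_cp_bounded (hs_right1 k ug)) y.
  have := minw _ _ F g uF ug y.
  set A := product_form _ _ _ _; set B := product_form _ _ _ _ => A0.
  rewrite -normrN opprB => /add_conj_ge.
  rewrite rmorphB /= (geC0_conj A0).
  set Y := \sum_i _ => le.
  rewrite -[X in 0 <= X](subrK (A + A)) addr_ge0 ?(addr_ge0 A0) //.
  by move: le; congr (0 <= _); rewrite /d'; ring.
have /c_tensorP cv := S_nuc min_v.
have cphi_lam : cp_bop (phi \o lam N : {linear S_ N -> bop H}).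
  by move=> m A /cp_lam/cphi; rewrite -map_mx_comp.
have com_lam : commuting (phi \o lam N : {linear S_ N -> bop H}) psi.
  by move=> s t; exact: com.
have := cv H (phi \o lam N) psi cphi_lam cpsi com_lam x.
rewrite !product_formD product_formZ product_form1 (product_form_adjoint _ vv') //.
rewrite /= (lam_coe N).1 -product_form1 -/one.
have := add_conj_ge (approx H phi psi c cphi cpsi c0 phic psic x).
set A := product_form _ _ w x; set B := product_form _ _ v x => h1 h2.
have := addr_ge0 h1 h2; congr (0 <= _).
by rewrite rmorphB /= /C /d'; ring.
Qed.

(** The result on real parts, applied to [w] and to the two multiples of its
    skew-adjoint part. *)
Lemma min_tensor_c n (w : 'M[tensor S T]_n) : min_tensor w -> c_tensor w.
Proof.
move=> minw; apply/c_tensorP => H phi psi cphi cpsi com x.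
have [w' ww'] := adjoint_tensors_exists w.
pose z s := tensor_mxZ (s * 'i) (w + tensor_mxZ (-1) w').
have formz s (K : hilbert R) (f : {linear S -> bop K}) (g : {linear T -> bop K}) y :
    cp_bop f -> cp_bop g -> commuting f g -> product_form f g (z s) y =
    s * ('i * (product_form f g w y - (product_form f g w y)^*)).
  move=> cf cg cfg; rewrite product_formZ product_formD product_formZ.
  by rewrite (product_form_adjoint _ ww') // mulN1r mulrA.
have minz s : min_tensor (z s).
  apply/min_tensorP => k m f g uf ug y.
  rewrite formz; [|exact: hs_left_cp|exact: hs_right_cp|exact: hs_commuting].
  move/min_tensorP: minw => /(_ k m f g uf ug y) /geC0_conj ->.
  by rewrite subrr !mulr0.
set Q := product_form phi psi w x.
(* The form of [z s] is real, so twice its real part is twice itself. *)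
have DR : ('i * (Q - Q^*))^* = 'i * (Q - Q^*).
  by rewrite rmorphM rmorphB /= conjCK conjCi mulNr -mulrN opprB.
have pos1 := min_tensor_real_part (minz 1) cphi cpsi com x.
have neg1 := min_tensor_real_part (minz (-1)) cphi cpsi com x.
have D0 : 'i * (Q - Q^*) = 0.
  move: pos1 neg1; rewrite !formz // -/Q !mul1r !mulN1r DR rmorphN /= DR.
  rewrite -mulr2n -mulr2n !pmulrn_lge0 // oppr_ge0 => D0 D0'.
  by apply/eqP; rewrite eq_le D0 D0'.
have QR : Q^* = Q.
  by move/eqP: D0; rewrite mulf_eq0 (negbTE (neq0Ci _)) /= subr_eq0 => /eqP.
have := min_tensor_real_part minw cphi cpsi com x.
by rewrite -/Q QR -mulr2n pmulrn_lge0.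
Qed.

End InductiveLimit.

Theorem theorem4p3 (R : realType) (S_ : nat -> osys R)
    (u : forall n, {linear S_ n -> S_ n.+1})
    (hu : forall n, unital_coe (u n))
    (hnuc : forall n, nuclear (@min_tensor R) (@c_tensor R) (S_ n))
    (S : osys R) (lam : forall n, {linear S_ n -> S})
    (hlim : is_inductive_limit u lam) :
  nuclear (@min_tensor R) (@c_tensor R) S.
Proof.
have [lam_coe lam_u clos _] := hlim.
move=> T; split; first by exists id.
move=> n w; rewrite map_mx_id //; split; last exact: c_tensor_min.
apply: (@min_tensor_c R S_ u S lam) => //.
- move=> s e e0; have /clos/(_ e e0) [_ [N [x ->]] le] := os_valP s.
  by exists N, x.
- move=> N m v /(hnuc N T).2.
  by rewrite map_mx_id.
Qed.
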